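(* Let $p\in\{2,3,5,7,13\}$. There is an algebraic function $I_p(x,y)$ such that the matrix $(M_{ij})_{i,j\ge1}$ of $U_{(0)}$ with respect to the basis $\{d_p^n\}_{n\ge1}$ satisfies the formal power series identity $$\sum_{i=1}^\infty\sum_{j=1}^\infty M_{ij}x^iy^j=\frac{y}{p}\,\frac{\partial}{\partial y}\log I_p(x,y).$$
   Context: $\Delta(q)=q\prod_{n\ge1}(1-q^n)^{24}$ and $d_p=\sqrt[p-1]{\Delta(q^p)/\Delta(q)}\in q+q^2\mathbb Z[[q]]$, a uniformizer of the genus zero curve $X_0(p)$. $U_{(0)}$ is Atkin's operator $U(\sum a_nq^n)=\sum a_{pn}q^n$ acting on $p$-adic overconvergent cusp forms of tame level $1$ and weight $0$; $M_{ij}$ is defined by $U(d_p^j)=\sum_{i\ge1}M_{ij}d_p^i$. *)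

(* Defs.v *)
From mathcomp Require Import all_boot all_order all_algebra.
Set Implicit Arguments. Unset Strict Implicit. Unset Printing Implicit Defensive.
Import GRing.Theory Num.Theory.
Local Open Scope ring_scope.

Definition fps := nat -> rat.

Definition fone : fps := fun n => (n == 0%N)%:R.
Definition fmul (a b : fps) : fps :=
  fun n => \sum_(i < n.+1) a i * b (n - i)%N.
Definition fpow (a : fps) (k : nat) : fps := iter k (fmul a) fone.

(* Delta(q) = q prod_{m>=1} (1-q^m)^24 ; its n-th coefficient only depends on
   the factors with m <= n *)
Definition Delta : fps :=
  fun n => ('X * \prod_(1 <= m < n.+1) (1 - 'X^m) ^+ 24 : {poly rat})`_n.

Definition Delta_at_pow (p : nat) : fps :=
  fun n => if (p %| n)%N then Delta (n %/ p)%N else 0.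

Definition U_op (p : nat) (f : fps) : fps := fun n => f (p * n)%N.

(* two-variable formal power series over Q: a i j = coefficient of x^i y^j *)
Definition fps2 := nat -> nat -> rat.

Definition fone2 : fps2 := fun i j => ((i == 0%N) && (j == 0%N))%:R.
Definition fmul2 (a b : fps2) : fps2 :=
  fun i j => \sum_(k < i.+1) \sum_(l < j.+1) a k l * b (i - k)%N (j - l)%N.
Definition fpow2 (a : fps2) (k : nat) : fps2 := iter k (fmul2 a) fone2.

Definition y_dy (a : fps2) : fps2 := fun i j => j%:R * a i j.

(* a polynomial in Q[x,y], written as a polynomial in y with coefficients in
   Q[x], seen as a two-variable power series *)
Definition poly2 (P : {poly {poly rat}}) : fps2 := fun i j => (P`_j)`_i.

Definition algebraic2 (I : fps2) : Prop :=
  exists a : seq {poly {poly rat}},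
    has (fun P => P != 0) a /\
    forall i j, \sum_(k < size a) fmul2 (poly2 a`_k) (fpow2 I k) i j = 0.

(* Main.v *)
Require Import Defs.
From HB Require Import structures.
From mathcomp Require Import all_boot all_order all_algebra all_field.
From mathcomp Require Import boolp.
From mathcomp Require Import ring lra zify.
Set Implicit Arguments. Unset Strict Implicit. Unset Printing Implicit Defensive.
Import GRing.Theory Num.Theory.
Local Open Scope ring_scope.

(** The power series d(z^i q), for z a primitive p-th root of unity and i < p, are
    the conjugates of d over Q((q^p)), and their power sums are p U(d^j)(q^p).  Hence
    the generating function of p M is - y d/dy log of prod_i (1 - y d(z^i q)), rewritten
    in terms of x = d(q^p), and I is the inverse of that product.  So everything rests
    on the modular equation between d(q) and d(q^p), which follows from j(q) = J(d(q))
    and j(q^p) = J(1/(k d(q))) with k = p^(12/(p-1)) and J an explicit rational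
    function: J(d(q^p)) = J(1/(k d(q))).

    These two expressions of j are obtained formally.  The Eisenstein series satisfy
    Ramanujan's differential system (by the elementary evaluation of the convolutions
    of divisor sums).  Let t = q + ... be the power series with J(t) = j, and let
    w = t'/t, where ' is q d/dq.  The series P2, Q2, R2 given by the expected formulas
    for E2(q^p), E4(q^p), E6(q^p) in terms of E2, w and t solve the system satisfied
    by these three series, and the system has only one such solution.  In particular
    t'/t = (p E2(q^p) - E2(q))/(p-1), which is also the logarithmic derivative of d,
    and therefore t = d. *)

(** * Formal power series *)

(** No analytic modularity is available for formal series, so uniqueness for a differential system
    takes its place: the system solved by the Eisenstein series at q^p leaves a single coefficient
    free, that of q^p, and the leading term of the discriminant fixes it.

    With x = d(q^p), the modular equation J(x) = J(1/(k d)) is a polynomial equation of degree p + 1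
    in y = 1/d, whereas d has only p conjugates. The remaining root is y = k x, where both sides are
    J(x). Dividing out its factor gives I = (k x - y) / (x N(y) - B(x) A(x)^3 y), where N is the
    reversal of B A2^3 and j(q) = B(d) A(d)^3 / d, j(q^p) = B(d) A2(d)^3 / d^p. Thus I is even a
    rational function.

    This quotient cannot be formed directly in Q[[x]][[y]]: the denominator has constant term k x in
    y and is not a unit. Therefore I is obtained as the solution of a linear differential equation,
    and the relation of degree 1 is proved afterwards. The conjugates live over the algebraic
    numbers, so identities about them are pulled back to Q along an injective substitution for x. *)

Record pseries (R : Type) := PSeries { coefs :> nat -> R }.

Lemma pseriesP (R : Type) (f g : pseries R) : (forall n, f n = g n) -> f = g.
Proof. by case: f g => [f] [g] /= /funext ->. Qed.

HB.instance Definition _ (R : Type) := gen_eqMixin (pseries R).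
HB.instance Definition _ (R : Type) := gen_choiceMixin (pseries R).

Section Ring.
Variable R : comNzRingType.
Implicit Types f g h : pseries R.

Definition ps_add f g := PSeries (fun n => f n + g n).
Definition ps_opp f := PSeries (fun n => - f n).
Definition ps_zero := PSeries (fun=> 0 : R).
Definition ps_const (c : R) := PSeries (fun n => if n == 0%N then c else 0).
Definition ps_mul f g := PSeries (fun n => \sum_(i < n.+1) f i * g (n - i)%N).

Lemma ps_addA : associative ps_add.
Proof. by move=> f g h; apply: pseriesP => n /=; rewrite addrA. Qed.
Lemma ps_addC : commutative ps_add.
Proof. by move=> f g; apply: pseriesP => n /=; rewrite addrC. Qed.
Lemma ps_add0 : left_id ps_zero ps_add.
Proof. by move=> f; apply: pseriesP => n /=; rewrite add0r. Qed.
Lemma ps_addN : left_inverse ps_zero ps_opp ps_add.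
Proof. by move=> f; apply: pseriesP => n /=; rewrite addNr. Qed.

HB.instance Definition _ :=
  GRing.isZmodule.Build (pseries R) ps_addA ps_addC ps_add0 ps_addN.

Definition trunc N f : {poly R} := \poly_(i < N) f i.

Lemma coef_trunc N f n : (n < N)%N -> (trunc N f)`_n = f n.
Proof. by rewrite coef_poly => ->. Qed.

Lemma ps_mul_trunc N f g (a b : {poly R}) n : (n < N)%N ->
  (forall i, (i < N)%N -> a`_i = f i) -> (forall i, (i < N)%N -> b`_i = g i) ->
  ps_mul f g n = (a * b)`_n.
Proof.
move=> nN ha hb; rewrite coefM /=; apply: eq_bigr => i _.
by rewrite ha ?hb // (leq_ltn_trans _ nN) ?leq_subr // -ltnS.
Qed.

Lemma ps_mulA : associative ps_mul.
Proof.
move=> f g h; apply: pseriesP => n.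
have T k i : (i < n.+1)%N -> (trunc n.+1 k)`_i = k i by apply: coef_trunc.
rewrite (@ps_mul_trunc n.+1 f _ (trunc n.+1 f) (trunc n.+1 g * trunc n.+1 h)) //.
- rewrite mulrA; symmetry; apply: (@ps_mul_trunc n.+1) => // [i|] hi; last exact: T.
  by symmetry; apply: (@ps_mul_trunc n.+1) => //; apply: T.
- exact: T.
- by move=> i hi; symmetry; apply: (@ps_mul_trunc n.+1) => //; apply: T.
Qed.

Lemma ps_mulC : commutative ps_mul.
Proof.
move=> f g; apply: pseriesP => n.
have T k i : (i < n.+1)%N -> (trunc n.+1 k)`_i = k i by apply: coef_trunc.
rewrite (@ps_mul_trunc n.+1 f _ _ _ _ _ (T f) (T g)) // mulrC.
by symmetry; apply: (@ps_mul_trunc n.+1) => //; apply: T.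
Qed.

Lemma ps_const_mul c f n : ps_mul (ps_const c) f n = c * f n.
Proof.
rewrite /= big_ord_recl /= subn0 big1 ?addr0 // => i _.
by rewrite /= mul0r.
Qed.

Lemma ps_mul1 : left_id (ps_const 1) ps_mul.
Proof. by move=> f; apply: pseriesP => n; rewrite ps_const_mul mul1r. Qed.

Lemma ps_mulD : left_distributive ps_mul ps_add.
Proof.
move=> f g h; apply: pseriesP => n /=; rewrite -big_split /=.
by apply: eq_bigr => i _; rewrite mulrDl.
Qed.

Lemma ps_1neq0 : ps_const 1 != 0.
Proof. by apply/eqP => /(congr1 (fun f => coefs f 0)) /= /eqP; rewrite oner_eq0. Qed.

HB.instance Definition _ := GRing.Zmodule_isComNzRing.Build (pseries R)
  ps_mulA ps_mulC ps_mul1 ps_mulD ps_1neq0.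

Lemma psD f g n : (f + g) n = f n + g n. Proof. by []. Qed.
Lemma psN f n : (- f) n = - f n. Proof. by []. Qed.
Lemma psB f g n : (f - g) n = f n - g n. Proof. by []. Qed.
Lemma ps0 n : (0 : pseries R) n = 0. Proof. by []. Qed.
Lemma ps1 n : (1 : pseries R) n = (n == 0%N)%:R. Proof. by rewrite /=; case: eqP. Qed.
Lemma psM f g n : (f * g) n = \sum_(i < n.+1) f i * g (n - i)%N. Proof. by []. Qed.
Lemma psM0 f g : (f * g) 0%N = f 0%N * g 0%N.
Proof. by rewrite psM big_ord_recl big_ord0 addr0. Qed.
Lemma psX0 f k : (f ^+ k) 0%N = f 0%N ^+ k.
Proof. by elim: k => [|k IH]; rewrite ?expr0 ?ps1 // !exprS psM0 IH. Qed.
Lemma ps_sum I (s : seq I) (P : pred I) (F : I -> pseries R) n :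
  (\sum_(i <- s | P i) F i) n = \sum_(i <- s | P i) F i n.
Proof. by elim/big_rec2: _ => // i x y _ <-. Qed.

Fact ps_const_is_additive : zmod_morphism ps_const.
Proof. by move=> a b; apply: pseriesP => -[|n] //=; rewrite subr0. Qed.
Fact ps_const_is_mul : monoid_morphism ps_const.
Proof.
by split=> // a b; apply: pseriesP => n; rewrite ps_const_mul /= ; case: eqP; rewrite ?mulr0.
Qed.
HB.instance Definition _ := GRing.isZmodMorphism.Build R (pseries R) ps_const ps_const_is_additive.
HB.instance Definition _ := GRing.isMonoidMorphism.Build R (pseries R) ps_const ps_const_is_mul.

Lemma psCM c f n : (ps_const c * f) n = c * f n.
Proof. exact: ps_const_mul. Qed.

Definition ps_X := PSeries (fun n => (n == 1%N)%:R : R).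

Lemma psXM f n : (ps_X * f) n = if n is m.+1 then f m else 0.
Proof.
rewrite psM; case: n => [|n]; first by rewrite big_ord_recl big_ord0 /= mul0r addr0.
rewrite big_ord_recl /= mul0r add0r big_ord_recl /= mul1r subn1 big1 ?addr0 // => i _.
by rewrite mul0r.
Qed.

Lemma psXnM k f n : (ps_X ^+ k * f) n = if (k <= n)%N then f (n - k)%N else 0.
Proof.
elim: k n => [|k IH] n; first by rewrite mul1r subn0.
by rewrite exprS -mulrA psXM; case: n => // n; rewrite IH.
Qed.

Lemma psXn k n : (ps_X ^+ k) n = (n == k)%:R.
Proof.
rewrite -[_ ^+ _]mulr1 psXnM ps1 subn_eq0 eqn_leq.
by case: (leqP k n); rewrite ?andbF ?andbT.
Qed.

Lemma ps_factorX f : f 0%N = 0 -> exists g, f = ps_X * g.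
Proof.
move=> f0; exists (PSeries (fun n => f n.+1)).
by apply: pseriesP => -[|n]; rewrite psXM.
Qed.

Definition eqmodX N f g := forall i, (i < N)%N -> f i = g i.

Lemma eqmodXM N f f' g g' : eqmodX N f f' -> eqmodX N g g' -> eqmodX N (f * g) (f' * g').
Proof.
move=> hf hg n nN; rewrite !psM; apply: eq_bigr => i _.
by rewrite hf ?hg // (leq_ltn_trans _ nN) ?leq_subr // -ltnS.
Qed.

Lemma eqmodXMS N h f g : h 0%N = 0 -> eqmodX N f g -> eqmodX N.+1 (h * f) (h * g).
Proof.
move=> /ps_factorX[h' ->] e; rewrite -!mulrA => -[|n] hn; rewrite !psXM //.
by apply: (@eqmodXM N).
Qed.

(** Each application of such a map settles one more coefficient, so coefficient n is final from
    iterate n + 1 on. The fixed point yields inverses, the solution of J(t) = j, and the solution of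
    a linear differential equation. *)
Definition contracting (F : pseries R -> pseries R) :=
  forall N f g, eqmodX N f g -> eqmodX N.+1 (F f) (F g).

Definition ps_fix (F : pseries R -> pseries R) := PSeries (fun n => iter n.+1 F 0 n).

Lemma ps_fixE F : contracting F -> F (ps_fix F) = ps_fix F.
Proof.
move=> cF.
have it N m : (N <= m)%N -> eqmodX N (iter m F 0) (iter N F 0).
  elim: N m => [|N IH] [|m] // Nm; rewrite !iterS; exact/cF/IH.
have fx N : eqmodX N (ps_fix F) (iter N F 0).
  by move=> i iN; rewrite /= -[F _]iterS; symmetry; apply: it.
apply: pseriesP => n.
by rewrite (cF n _ _ (fx n)).
Qed.
End Ring.

(** * Inverses and integrality over a field *)

Section Idomain.
Variable K : fieldType.
Implicit Types f g h : pseries K.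

(** The inverse of f solves g = (1 - (f - f_0) g) / f_0, a contraction because f - f_0 has no
    constant term. On non-units the inverse is f itself, as the ring structure demands. *)
Definition ps_unit : pred (pseries K) := fun f => f 0%N != 0.
Definition ps_inv f := if ps_unit f then
  ps_fix (fun g => ps_const (f 0%N)^-1 * (1 - (f - ps_const (f 0%N)) * g)) else f.

Lemma ps_mulVf : {in ps_unit, left_inverse 1 ps_inv *%R}.
Proof.
move=> f uf; rewrite /ps_inv ifT //; set F := fun g => _.
have cF : contracting F.
  move=> N g h e; apply: eqmodXM => // i hi; rewrite !psB; congr (_ - _).
  by apply: (@eqmodXMS _ N) => //; rewrite psB /= subrr.
have: ps_const (f 0%N) * F (ps_fix F) = ps_const (f 0%N) * ps_fix F by rewrite ps_fixE.
rewrite /F mulrA -rmorphM divff // mul1r -/F mulrBl => /eqP; rewrite opprB addrA subr_eq addrC.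
by rewrite (inj_eq (addrI _)) mulrC => /eqP.
Qed.

Lemma ps_unitPl f g : g * f = 1 -> ps_unit f.
Proof.
move/(congr1 (fun f => coefs f 0)); rewrite psM0 ps1 /= => e; apply/eqP => f0.
by move/eqP: e; rewrite f0 mulr0 eq_sym oner_eq0.
Qed.

Lemma ps_inv_out : {in [predC ps_unit], ps_inv =1 id}.
Proof. by move=> f /negbTE uf; rewrite /ps_inv [ps_unit f]uf. Qed.

HB.instance Definition _ := GRing.ComNzRing_hasMulInverse.Build (pseries K)
  ps_mulVf ps_unitPl ps_inv_out.

Lemma ps_neq0P f : f != 0 -> exists k, exists2 g, f = ps_X K ^+ k * g & g 0%N != 0.
Proof.
move=> f0; have ex : exists n, f n != 0.
  apply: contrapT => nex; move/eqP: f0; apply; apply: pseriesP => n.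
  by apply/eqP; apply: contrapT => /negP h; apply: nex; exists n.
exists (ex_minn ex); case: ex_minnP => k fk mink.
exists (PSeries (fun n => f (k + n)%N)); last by rewrite /= addn0.
apply: pseriesP => n; rewrite psXnM /=; case: leqP => [/subnKC -> //|nk].
by apply/eqP; apply: contraTT nk => /mink; rewrite -leqNgt.
Qed.

Lemma ps_idomain f g : f * g = 0 -> (f == 0) || (g == 0).
Proof.
move=> fg; apply/orP; case: (eqVneq f 0) => [|/ps_neq0P[k [f' fE f'0]]]; [by left|right].
apply: contrapT => /negP /ps_neq0P[l [g' gE g'0]].
move/(congr1 (fun f => coefs f (k + l))): fg.
rewrite fE gE mulrACA -exprD psXnM leqnn subnn psM0 /= => /eqP.
by rewrite mulf_eq0 (negbTE f'0) (negbTE g'0).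
Qed.

HB.instance Definition _ := GRing.ComUnitRing_isIntegral.Build (pseries K) ps_idomain.

Lemma ps_unitE f : (f \is a GRing.unit) = (f 0%N != 0). Proof. by []. Qed.
End Idomain.

(** * The derivation q d/dq *)

Section Derivation.
Variable R : comNzRingType.
Implicit Types f g : pseries R.

Definition qD f := PSeries (fun n => n%:R * f n).

Lemma qDM f g : qD (f * g) = qD f * g + f * qD g.
Proof.
apply: pseriesP => n; rewrite psD !psM /= -big_split big_distrr /=.
apply: eq_bigr => i _; have le_i : (i <= n)%N by rewrite -ltnS.
by rewrite -{1}(subnK le_i) natrD; ring.
Qed.

Lemma qDD f g : qD (f + g) = qD f + qD g.
Proof. by apply: pseriesP => n; rewrite /= mulrDr. Qed.

Lemma qDN f : qD (- f) = - qD f.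
Proof. by apply: pseriesP => n; rewrite /= mulrN. Qed.

Lemma qD_const c : qD (ps_const c) = 0.
Proof. by apply: pseriesP => -[|n]; rewrite /= ?mul0r ?mulr0. Qed.

Lemma qD_int (z : int) : qD z%:~R = 0.
Proof. by rewrite -(rmorph_int (@ps_const R)) qD_const. Qed.

Lemma qD_nat n : qD n%:R = 0.
Proof. by rewrite pmulrn qD_int. Qed.

Lemma qD1 : qD 1 = 0. Proof. exact: qD_const. Qed.

Lemma qDX f k : qD (f ^+ k) = k%:R * f ^+ k.-1 * qD f.
Proof.
elim: k => [|[|k] IH]; first by rewrite expr0 qD1 !mul0r.
  by rewrite !expr1 mul1r expr0 mul1r.
by rewrite exprS qDM IH /= -!natr1 !exprS; ring.
Qed.

Lemma qD_X k : qD (ps_X R ^+ k) = k%:R * ps_X R ^+ k.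
Proof.
apply: pseriesP => n; rewrite -(rmorph_nat (@ps_const R)) psCM psXn.
rewrite [LHS]/= psXn; by case: eqP => [->|_]; rewrite ?mulr0.
Qed.

End Derivation.

Section IntPolynomialEvaluation.
Variable R : comNzRingType.
Implicit Types (P Q : {poly int}) (x : R).

(** The level polynomials have integer coefficients, so that one identity between them can be
    evaluated in every ring that occurs: power series, nested series, polynomials, fraction
    fields. *)
Definition ev P x : R := (map_poly intr P).[x].

Lemma evD P Q x : ev (P + Q) x = ev P x + ev Q x.
Proof. by rewrite /ev rmorphD hornerD. Qed.
Lemma evN P x : ev (- P) x = - ev P x.
Proof. by rewrite /ev rmorphN hornerN. Qed.
Lemma evM P Q x : ev (P * Q) x = ev P x * ev Q x.
Proof. by rewrite /ev rmorphM hornerM. Qed.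
Lemma evXn P k x : ev (P ^+ k) x = ev P x ^+ k.
Proof. by rewrite /ev rmorphXn horner_exp. Qed.
Lemma evX x : ev 'X x = x.
Proof. by rewrite /ev map_polyX hornerX. Qed.
Lemma evC c x : ev c%:P x = c%:~R.
Proof. by rewrite /ev map_polyC hornerC. Qed.
Lemma evn n x : ev n%:R x = n%:R.
Proof. by rewrite -polyC_natr evC natz -pmulrn. Qed.
Lemma ev0 x : ev 0 x = 0. Proof. exact: (evn 0). Qed.
Lemma ev1 x : ev 1 x = 1. Proof. exact: (evn 1). Qed.
Definition evE := (evn, ev1, ev0, evX, evC, evXn, evM, evN, evD).

End IntPolynomialEvaluation.

Lemma ev_rmorph (R S : comNzRingType) (phi : {rmorphism R -> S}) P x :
  phi (ev P x) = ev P (phi x).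
Proof.
rewrite /ev -horner_map -map_poly_comp; congr (_.[_]).
by apply: eq_map_poly => z /=; rewrite rmorph_int.
Qed.

Lemma qD_ev (R : comNzRingType) P (t : pseries R) : qD (ev P t) = ev P^`() t * qD t.
Proof.
elim/poly_ind: P => [|P c IH]; first by rewrite deriv0 !ev0 (qD_int _ 0) mul0r.
rewrite !evE qDD qDM qD_int IH derivD derivM derivC derivX !evE.
ring.
Qed.

Lemma ev_coef0 (R : comNzRingType) P (t : pseries R) : t 0%N = 0 -> ev P t 0%N = (P`_0)%:~R.
Proof.
move=> t0; elim/poly_ind: P => [|P c IH].
  by rewrite ev0 coef0.
rewrite !evE psD psM0 t0 mulr0 add0r coefD coefMX coefC eqxx add0r.
by rewrite -(rmorph_int (@ps_const R)).
Qed.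

(** * Substitution of power series *)

Section Composition.
Variables (R S : comNzRingType) (phi : {rmorphism R -> S}) (h : pseries S).

(* [ps_comp f] is f(X h), with phi applied to the coefficients of f; writing the
   substituted series as X h makes the substitution a total ring morphism. *)
Definition ps_comp (f : pseries R) : pseries S :=
  PSeries (fun n => \sum_(i < n.+1) phi (f i) * ((ps_X S * h) ^+ i) n).

Lemma ps_expX_small i n : (n < i)%N -> ((ps_X S * h) ^+ i) n = 0.
Proof. by rewrite exprMn psXnM ltnNge => /negbTE ->. Qed.

Lemma ps_horner (P : {poly S}) n :
  (map_poly (@ps_const S) P).[ps_X S * h] n = \sum_(i < n.+1) P`_i * ((ps_X S * h) ^+ i) n.
Proof.
pose N := (size P + n.+1)%N.
have hN : (size (map_poly (@ps_const S) P) <= N)%N.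
  by apply: leq_trans (size_poly _ _) _; apply: leq_addr.
rewrite (horner_coef_wide _ hN) ps_sum.
under eq_bigr => i _ do rewrite coef_map psCM.
rewrite -!(big_mkord xpredT (fun i => P`_i * ((ps_X S * h) ^+ i) n)).
rewrite (@big_cat_nat _ _ _ n.+1) //=; last by rewrite /N addnS ltnS leq_addl.
rewrite [X in _ + X]big_nat_cond [X in _ + X]big1 ?addr0 // => i /andP[/andP[ni _] _].
by rewrite ps_expX_small ?mulr0.
Qed.

Lemma ps_comp_horner N (f : pseries R) (P : {poly R}) n : (n < N)%N ->
  (forall i, (i < N)%N -> P`_i = f i) ->
  ps_comp f n = (map_poly (@ps_const S \o phi) P).[ps_X S * h] n.
Proof.
move=> nN hP; rewrite map_poly_comp_id0 ?rmorph0 //= ps_horner.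
by apply: eq_bigr => i _; rewrite coef_map /= hP // (leq_trans _ nN).
Qed.

Fact ps_comp_is_additive : zmod_morphism ps_comp.
Proof.
move=> f g; apply: pseriesP => n; rewrite /= -sumrN -big_split /=.
by apply: eq_bigr => i _; rewrite rmorphB mulrBl.
Qed.

Fact ps_comp_is_mul : monoid_morphism ps_comp.
Proof.
split=> [|f g]; apply: pseriesP => n.
  rewrite /= big_ord_recl big1 ?addr0 => [|i _]; last by rewrite rmorph0 mul0r.
  by rewrite rmorph1 mul1r expr0.
have T (k : pseries R) i : (i < n.+1)%N -> (trunc n.+1 k)`_i = k i by apply: coef_trunc.
rewrite (@ps_comp_horner n.+1 _ (trunc n.+1 f * trunc n.+1 g)) //; last first.
  by move=> i hi; symmetry; apply: (@ps_mul_trunc _ n.+1) => //; apply: T.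
rewrite rmorphM hornerM !psM; apply: eq_bigr => i _.
rewrite -(@ps_comp_horner n.+1 f) -?(@ps_comp_horner n.+1 g) //; try exact: T.
by rewrite ltnS leq_subr.
Qed.

HB.instance Definition _ := GRing.isZmodMorphism.Build (pseries R) (pseries S)
  ps_comp ps_comp_is_additive.
HB.instance Definition _ := GRing.isMonoidMorphism.Build (pseries R) (pseries S)
  ps_comp ps_comp_is_mul.

Lemma ps_compX : ps_comp (ps_X R) = ps_X S * h.
Proof.
apply: pseriesP => -[|n]; rewrite [LHS]/=.
  by rewrite big_ord1 rmorph0 mul0r psXM.
rewrite big_ord_recl rmorph0 mul0r add0r big_ord_recl rmorph1 mul1r expr1 big1 ?addr0 //.
by move=> i _; rewrite /= rmorph0 mul0r.
Qed.

End Composition.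

(** A nonzero series is X^k u with u of nonzero constant term; its image is (X h)^k times a series
    with nonzero constant term, hence nonzero in a domain. *)
Lemma ps_comp_inj (R S : fieldType) (phi : {rmorphism R -> S}) (h : pseries S) :
  h != 0 -> injective (ps_comp phi h).
Proof.
move=> h0 f g /eqP; rewrite -subr_eq0 -rmorphB => e; apply/eqP; rewrite -subr_eq0.
apply: contraTT e => /ps_neq0P[k [u -> u0]].
rewrite rmorphM rmorphXn /= ps_compX mulf_neq0 ?expf_neq0 //.
  rewrite mulf_neq0 //; apply/eqP => /(congr1 (fun f => coefs f 1)) /eqP.
  by rewrite /= oner_eq0.
apply/eqP => /(congr1 (fun f => coefs f 0)) /=.
by rewrite big_ord1 expr0 mulr1 => /eqP; rewrite fmorph_eq0 (negbTE u0).
Qed.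

Section Frobenius.
Variables (R : comNzRingType) (p : nat).
Hypothesis p_gt0 : (0 < p)%N.

(** The substitution q -> q^p, with q^p written as X X^(p-1) to fit the form of [ps_comp]. *)
Definition qpow : pseries R -> pseries R := ps_comp idfun (ps_X R ^+ p.-1).
HB.instance Definition _ := GRing.isZmodMorphism.Build (pseries R) (pseries R)
  qpow (ps_comp_is_additive _ _).
HB.instance Definition _ := GRing.isMonoidMorphism.Build (pseries R) (pseries R)
  qpow (ps_comp_is_mul _ _).
Arguments qpow : simpl never.

Lemma qpowE f n : qpow f n = if (p %| n)%N then f (n %/ p)%N else 0.
Proof.
rewrite [LHS]/=; under eq_bigr => i _ do rewrite -exprS prednK // -exprM psXn.
case: ifP => [/dvdnP[k ->]|ndv].
  have kn : (k < (k * p).+1)%N by rewrite ltnS leq_pmulr.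
  rewrite (bigD1 (Ordinal kn)) //= mulnK // [(p * k)%N]mulnC eqxx mulr1 big1 ?addr0 // => i.
  rewrite -val_eqE /= => /negbTE ik.
  by rewrite [(p * i)%N]mulnC eqn_pmul2r // eq_sym ik mulr0.
rewrite big1 // => i _; case: eqP => [e|]; last by rewrite mulr0.
by rewrite e dvdn_mulr in ndv.
Qed.

Lemma qD_qpow f : qD (qpow f) = p%:R * qpow (qD f).
Proof.
apply: pseriesP => n; rewrite -(rmorph_nat (@ps_const R)) psCM qpowE.
rewrite -[LHS]/(n%:R * qpow f n) qpowE.
case: ifP => [/dvdnP[k ->]|]; last by rewrite !mulr0.
by rewrite mulnK // natrM /=; ring.
Qed.

Lemma qpow0 f : qpow f 0%N = f 0%N.
Proof. by rewrite qpowE dvdn0 div0n. Qed.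

Lemma qpow_p f : qpow f p = f 1%N.
Proof. by rewrite qpowE dvdnn divnn p_gt0. Qed.
End Frobenius.

Section OfPoly.
Variable R : comNzRingType.

Definition ps_of_poly (P : {poly R}) : pseries R := PSeries (fun n => P`_n).

Fact ps_of_poly_is_additive : zmod_morphism ps_of_poly.
Proof. by move=> P Q; apply: pseriesP => n; rewrite /= coefB. Qed.
Fact ps_of_poly_is_mul : monoid_morphism ps_of_poly.
Proof.
split=> [|P Q]; apply: pseriesP => n; first by rewrite /= coef1; case: eqP.
by rewrite /= coefM.
Qed.
HB.instance Definition _ := GRing.isZmodMorphism.Build {poly R} (pseries R)
  ps_of_poly ps_of_poly_is_additive.
HB.instance Definition _ := GRing.isMonoidMorphism.Build {poly R} (pseries R)
  ps_of_poly ps_of_poly_is_mul.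

Lemma ps_of_polyX : ps_of_poly 'X = ps_X R.
Proof. by apply: pseriesP => n; rewrite /= coefX. Qed.
Lemma ps_of_polyC c : ps_of_poly c%:P = ps_const c.
Proof. by apply: pseriesP => n; rewrite /= coefC. Qed.
End OfPoly.

(** * Ramanujan's differential system *)

Lemma psM_low (R : comNzRingType) (f g : pseries R) n :
  eqmodX n g 0 -> (f * g) n = f 0%N * g n.
Proof.
move=> g0; rewrite psM big_ord_recl subn0 big1 ?addr0 // => i _.
by rewrite g0 ?mulr0 //= /bump /=; have := ltn_ord i; lia.
Qed.

(** The product linearised at the first coefficient where the factors may differ; this turns a
    differential system into linear equations for the differences of the n-th coefficients. *)
Lemma psM_diff (R : comNzRingType) (f f' g g' : pseries R) n : (0 < n)%N ->
  eqmodX n f f' -> eqmodX n g g' ->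
  (f * g) n - (f' * g') n = f 0%N * (g n - g' n) + g 0%N * (f n - f' n).
Proof.
move=> n0 ef eg; have Z h h' : eqmodX n h h' -> eqmodX n (h - h') 0.
  by move=> e i hi; rewrite psB e ?subrr.
rewrite -psB; have -> : f * g - f' * g' = f * (g - g') + g' * (f - f') by ring.
by rewrite psD !psM_low ?psB ?(eg 0%N) //; apply: Z.
Qed.

Lemma ps_nat_neq0 n : (n.+1%:R : pseries rat) != 0.
Proof.
apply/eqP => /(congr1 (fun f => coefs f 0)) /eqP.
by rewrite -(rmorph_nat (@ps_const rat)) /= pnatr_eq0.
Qed.

Lemma ps_neq0 (K : fieldType) (f : pseries K) n : f n != 0 -> f != 0.
Proof. by apply: contraNneq => ->. Qed.

(** The difference h satisfies q h' = u h. If its coefficients below n vanish, coefficient n gives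
    (n - 1) h_n = 0, so only h_1 is free. *)
Lemma qD_logderiv_inj (u f g : pseries rat) : u 0%N = 1 ->
  qD f = f * u -> qD g = g * u -> f 1%N = g 1%N -> f = g.
Proof.
move=> u0 Df Dg fg1; apply/eqP; rewrite -subr_eq0; apply/eqP.
have : qD (f - g) = u * (f - g) by rewrite qDD qDN Df Dg; ring.
have : (f - g) 1%N = 0 by rewrite psB fg1 subrr.
move: (f - g) => h h1 Dh; apply: pseriesP => n; rewrite ps0.
elim/ltn_ind: n => n IH.
have := congr1 (fun f => coefs f n) Dh; rewrite psM_low // u0 mul1r /=.
case: n IH => [|[|n]] IH // /eqP; first by rewrite mul0r eq_sym => /eqP.
rewrite -subr_eq0 -{2}[h _]mul1r -mulrBl mulf_eq0 => /orP[|/eqP //].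
by rewrite -natr1 addrK pnatr_eq0.
Qed.

Definition ramanujan (m : nat) (P Q R : pseries rat) : Prop :=
  [/\ P 0%N = 1, Q 0%N = 1 & R 0%N = 1] /\
  [/\ 12 * qD P = m%:R * (P ^+ 2 - Q), 3 * qD Q = m%:R * (P * Q - R)
    & 2 * qD R = m%:R * (P * R - Q ^+ 2)].

(* The linearised system at (1,1,1) has eigenvalues m, 0, 0, so only the coefficient
   of q^m is not forced; the discriminant detects it. *)
Lemma ramanujan_inj m P Q R P' Q' R' : (0 < m)%N ->
  ramanujan m P Q R -> ramanujan m P' Q' R' ->
  (Q ^+ 3 - R ^+ 2) m = (Q' ^+ 3 - R' ^+ 2) m -> [/\ P = P', Q = Q' & R = R'].
Proof.
move=> m0 [[P0 Q0 R0] [DP DQ DR]] [[P0' Q0' R0'] [DP' DQ' DR']] disc.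
suff H n : [/\ P n = P' n, Q n = Q' n & R n = R' n].
  by split; apply: pseriesP => n; case: (H n).
elim/ltn_ind: n => n IH.
have [n0|n0] := posnP n; first by rewrite n0 P0 P0' Q0 Q0' R0 R0'.
have eP : eqmodX n P P' by move=> i /IH[].
have eQ : eqmodX n Q Q' by move=> i /IH[].
have eR : eqmodX n R R' by move=> i /IH[].
have cf (c d : nat) (f f' h h' : pseries rat) :
    c%:R * qD f = d%:R * h -> c%:R * qD f' = d%:R * h' ->
    c%:R * (n%:R * (f n - f' n)) = d%:R * (h n - h' n) :> rat.
  move=> /(congr1 (fun f => coefs f n)) e /(congr1 (fun f => coefs f n)) e'.
  move: e e'; rewrite -!(rmorph_nat (@ps_const rat)) !psCM /= => e e'.
  by rewrite !mulrBr e e'.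
have Pd := cf 12%N m _ _ _ _ DP DP'.
have Qd := cf 3%N m _ _ _ _ DQ DQ'.
have Rd := cf 2%N m _ _ _ _ DR DR'.
have split4 (a b c d : rat) : a - b - (c - d) = (a - c) - (b - d) by ring.
move: Pd; rewrite !psB split4 !expr2 psM_diff // P0 mul1r => Pd.
move: Qd; rewrite !psB split4 psM_diff // P0 Q0 !mul1r => Qd.
move: Rd; rewrite !psB split4 !expr2 !psM_diff // P0 Q0 R0 !mul1r => Rd.
have disc' : n = m -> 3 * (Q n - Q' n) - 2 * (R n - R' n) = 0.
  move=> nm; rewrite -nm in disc; move/eqP: disc; rewrite -subr_eq0 !psB split4.
  have eQQ : eqmodX n (Q * Q) (Q' * Q') by apply: eqmodXM.
  rewrite !exprS !expr0 !mulr1 !psM_diff // psM0 Q0 R0 => /eqP <-; ring.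
move: Pd Qd Rd disc'.
set x := P n - P' n; set y := Q n - Q' n; set z := R n - R' n => Pd Qd Rd disc'.
suff [x0 y0 z0] : [/\ x = 0, y = 0 & z = 0].
  by split; apply/eqP; rewrite -subr_eq0; apply/eqP.
have n0' : n%:R != 0 :> rat by rewrite pnatr_eq0 -lt0n.
have m0' : m%:R != 0 :> rat by rewrite pnatr_eq0 -lt0n.
have [nm|/eqP nm] := eqVneq n m.
  have D := disc' nm; rewrite nm in Pd Qd Rd.
  have {}Pd : 12 * x = x + x - y by apply: (mulfI m0'); rewrite -Pd; ring.
  have {}Qd : 3 * y = y + x - z by apply: (mulfI m0'); rewrite -Qd; ring.
  by split; lra.
have nm' : n%:R - m%:R != 0 :> rat by rewrite subr_eq0 eqr_nat; apply/eqP.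
have x0 : x = 0.
  set N := n%:R in Pd Qd Rd n0' nm'; set M := m%:R in Pd Qd Rd m0' nm'.
  have nz : 72 * N ^+ 2 * (N - M) != 0.
    by apply: mulf_neq0 => //; apply: mulf_neq0; [rewrite pnatr_eq0|exact: expf_neq0].
  apply: (mulfI nz); rewrite mulr0.
  (* Cramer's rule: the multipliers are the cofactors of the column of x, and the determinant of the
     system is 72 N^2 (N - M). *)
  transitivity ((6 * N + M) * (N - M) * (12 * (N * x) - M * (x + x - y))
      - M * (2 * N - M) * (3 * (N * y) - M * (y + x - z))
      + M ^+ 2 * (2 * (N * z) - M * (z + x - (y + y)))); first by ring.
  by rewrite Pd Qd Rd !subrr !mulr0 subr0 addr0.
have y0 : y = 0 by apply: (mulfI m0'); move: Pd; rewrite x0; lra.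
by split=> //; apply: (mulfI m0'); move: Qd; rewrite x0 y0; lra.
Qed.

(** * Solving J(t) = j *)

(* The classical expressions of j in the Hauptmodul t = d_p: j(q) = B A^3 / t,
   j(q) - m = C S^2 / t, j(q^p) = B A2^3 / t^p and j(q^p) - m = C S2^2 / t^p, where B and C
   collect the elliptic points of order 3 and 2.  With w = qD t / t, the Eisenstein series
   are E4 = w^2 A / (B C) and E6 = w^3 S / (B^2 C) at q, and the same with A2 and S2 at q^p;
   the differential identities say that these satisfy Ramanujan's system.  The number
   m = 1728 is a variable because unification tends to unfold large numerals. *)
Record level_data (p m : nat) (B C A S A2 S2 : {poly int}) : Prop := LevelData {
  ld_const : [/\ B`_0 = 1, C`_0 = 1 & A`_0 = 1] /\ [/\ S`_0 = 1, A2`_0 = 1 & S2`_0 = 1];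
  ld_disc : B * A ^+ 3 - C * S ^+ 2 = m%:R * 'X;
  ld_disc2 : B * A2 ^+ 3 - C * S2 ^+ 2 = m%:R * 'X ^+ p;
  ld_dA : 'X * (B^`() * A + 3 * B * A^`()) - B * A = - S;
  ld_dA2 : 'X * (B^`() * A2 + 3 * B * A2^`()) - p%:R * B * A2 = - (p%:R * S2);
  ld_dS2 : 'X * (C^`() * S2 + 2 * C * S2^`()) - p%:R * C * S2 = - (p%:R * A2 ^+ 2);
  ld_weight2 : (p%:R - 1) ^+ 2 * B * C - (p%:R ^+ 2 * A2 - A) =
    - (2 * (p%:R - 1) * (B * C - 4 * 'X * B^`() * C - 3 * 'X * B * C^`()))
}.

(** A certificate of ideal membership: a - b is exhibited as a combination of differences of known
    equations, and [ring] only has to check an identity in free variables. The same holds for the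
    variants with more equations. *)
Lemma lincomb1 (R : comNzRingType) (a b c l r : R) :
  l = r -> a - b = c * (l - r) -> a = b.
Proof. by move=> -> /eqP; rewrite subrr mulr0 subr_eq0 => /eqP. Qed.

Lemma lincomb2 (R : comNzRingType) (a b c l r c' l' r' : R) :
  l = r -> l' = r' -> a - b = c * (l - r) + c' * (l' - r') -> a = b.
Proof. by move=> -> -> /eqP; rewrite !subrr !mulr0 addr0 subr_eq0 => /eqP. Qed.

Lemma lincomb3 (R : comNzRingType) (a b c l r c' l' r' c'' l'' r'' : R) :
  l = r -> l' = r' -> l'' = r'' ->
  a - b = c * (l - r) + c' * (l' - r') + c'' * (l'' - r'') -> a = b.
Proof. by move=> -> -> -> /eqP; rewrite !subrr !mulr0 !addr0 subr_eq0 => /eqP. Qed.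

Lemma lincomb4 (R : comNzRingType) (a b c l r c' l' r' c'' l'' r'' d u v : R) :
  l = r -> l' = r' -> l'' = r'' -> u = v ->
  a - b = c * (l - r) + c' * (l' - r') + c'' * (l'' - r'') + d * (u - v) -> a = b.
Proof. by move=> -> -> -> -> /eqP; rewrite !subrr !mulr0 !addr0 subr_eq0 => /eqP. Qed.

Lemma lincomb6 (R : comNzRingType)
    (a b c1 l1 r1 c2 l2 r2 c3 l3 r3 c4 l4 r4 c5 l5 r5 c6 l6 r6 : R) :
  l1 = r1 -> l2 = r2 -> l3 = r3 -> l4 = r4 -> l5 = r5 -> l6 = r6 ->
  a - b = c1 * (l1 - r1) + c2 * (l2 - r2) + c3 * (l3 - r3) + c4 * (l4 - r4)
    + c5 * (l5 - r5) + c6 * (l6 - r6) -> a = b.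
Proof. by move=> -> -> -> -> -> -> /eqP; rewrite !subrr !mulr0 !addr0 subr_eq0 => /eqP. Qed.

Lemma eqmodX_ev (R : comNzRingType) (P : {poly int}) N (f g : pseries R) :
  eqmodX N f g -> eqmodX N (ev P f) (ev P g).
Proof.
move=> e; elim/poly_ind: P => [|P c IH]; first by rewrite !ev0.
by rewrite !evE => i hi; rewrite !psD; congr (_ + _); apply: (eqmodXM IH e).
Qed.

Section Level.
Variables (p m : nat) (B C A S A2 S2 : {poly int}).
Hypotheses (p_gt1 : (1 < p)%N) (m_gt0 : (0 < m)%N).
Hypothesis LD : level_data p m B C A S A2 S2.
Variables (P Q R : pseries rat).
Hypothesis PQR : ramanujan 1 P Q R.
Hypothesis disc1 : (Q ^+ 3 - R ^+ 2) 1%N = m%:R.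

Let A_ := pseries rat.

Let m_neq0 : m%:R != 0 :> rat. Proof. by rewrite pnatr_eq0 -lt0n. Qed.
Let ps_m_neq0 : m%:R != 0 :> A_. Proof. by case: (m) m_gt0 => // n _; apply: ps_nat_neq0. Qed.

(** J(t) = j reads t = (1/j) B(t) A(t)^3. Since 1/j = [dl] / Q^3 has no constant term, the
    right-hand side is a contraction in t. *)
Lemma hauptmodul_exists : exists t dl : A_, [/\ t 0%N = 0, t 1%N = 1,
  m%:R * dl = Q ^+ 3 - R ^+ 2, dl 0%N = 0 /\ dl 1%N = 1 &
  t * Q ^+ 3 = dl * (ev B t * ev A t ^+ 3)].
Proof.
have [[P0 Q0 R0] _] := PQR.
have uQ : Q ^+ 3 \is a GRing.unit by rewrite ps_unitE psX0 Q0 expr1n oner_neq0.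
pose dl : A_ := ps_const (m%:R^-1) * (Q ^+ 3 - R ^+ 2).
have dlE : m%:R * dl = Q ^+ 3 - R ^+ 2.
  rewrite -(rmorph_nat (@ps_const rat)) /dl mulrA -rmorphM divff ?rmorph1 ?mul1r //.
have dl0 : dl 0%N = 0 by rewrite psCM psB !psX0 Q0 R0 !expr1n subrr mulr0.
have dl1 : dl 1%N = 1 by rewrite psCM disc1 mulVf.
pose g := dl / Q ^+ 3.
have g0 : g 0%N = 0 by rewrite /g psM0 dl0 mul0r.
have gQ : g * Q ^+ 3 = dl by rewrite /g divrK.
have g1 : g 1%N = 1.
  have := congr1 (fun f => coefs f 1) gQ.
  by rewrite mulrC psM_low ?dl1 ?psX0 ?Q0 ?expr1n ?mul1r // => -[|[]].
pose F t := g * ev (B * A ^+ 3) t.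
have cF : contracting F.
  by move=> N f f' e; apply: eqmodXMS => //; apply: eqmodX_ev.
pose t := ps_fix F; have tE : t = g * ev (B * A ^+ 3) t by rewrite -[LHS](ps_fixE cF).
have t0 : t 0%N = 0 by rewrite tE psM0 g0 mul0r.
exists t, dl; split=> //.
  rewrite tE mulrC psM_low ?g1 ?mulr1; last by case=> //.
  case: (ld_const LD) => -[B0 _ A0] _.
  by rewrite !evE psM0 psX0 !ev_coef0 // B0 A0 expr1n mulr1.
by rewrite {1}tE -gQ !evE; ring.
Qed.

Lemma qD_disc (dl : A_) : m%:R * dl = Q ^+ 3 - R ^+ 2 -> qD dl = P * dl.
Proof.
move=> dlE; have [_ [_ DQ DR]] := PQR.
apply: (mulfI ps_m_neq0).
have : qD (m%:R * dl) = m%:R * qD dl by rewrite qDM qD_nat mul0r add0r.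
rewrite mulrCA dlE qDD qDN !qDX /= => <-.
by apply: (lincomb2 (c := Q ^+ 2) (c' := - R) DQ DR); ring.
Qed.

Section Hauptmodul.
Variables t dl : A_.
Hypothesis t0 : t 0%N = 0.
Hypothesis t1 : t 1%N = 1.
Hypothesis dlE : m%:R * dl = Q ^+ 3 - R ^+ 2.
Hypothesis dl0 : dl 0%N = 0.
Hypothesis dl1 : dl 1%N = 1.
Hypothesis tQ : t * Q ^+ 3 = dl * (ev B t * ev A t ^+ 3).

Let b := ev B t. Let c := ev C t. Let a := ev A t. Let s := ev S t.
Let a2 := ev A2 t. Let s2 := ev S2 t.
Let b' := ev B^`() t. Let c' := ev C^`() t. Let a' := ev A^`() t.
Let a2' := ev A2^`() t. Let s2' := ev S2^`() t.

Lemma ev_level0 : [/\ b 0%N = 1, c 0%N = 1 & a 0%N = 1] /\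
  [/\ s 0%N = 1, a2 0%N = 1 & s2 0%N = 1].
Proof.
case: (ld_const LD) => -[B0 C0 A0] [S0 A20 S20].
by split; split; rewrite ev_coef0 // (B0, C0, A0, S0, A20, S20).
Qed.

Lemma ev_disc : b * a ^+ 3 - c * s ^+ 2 = m%:R * t.
Proof. by have := congr1 (fun F => ev F t) (ld_disc LD); rewrite /= !evE. Qed.
Lemma ev_disc2 : b * a2 ^+ 3 - c * s2 ^+ 2 = m%:R * t ^+ p.
Proof. by have := congr1 (fun F => ev F t) (ld_disc2 LD); rewrite /= !evE. Qed.
Lemma ev_dA : t * (b' * a + 3 * b * a') - b * a = - s.
Proof. by have := congr1 (fun F => ev F t) (ld_dA LD); rewrite /= !evE. Qed.
Lemma ev_dA2 : t * (b' * a2 + 3 * b * a2') - p%:R * b * a2 = - (p%:R * s2).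
Proof. by have := congr1 (fun F => ev F t) (ld_dA2 LD); rewrite /= !evE. Qed.
Lemma ev_dS2 : t * (c' * s2 + 2 * c * s2') - p%:R * c * s2 = - (p%:R * a2 ^+ 2).
Proof. by have := congr1 (fun F => ev F t) (ld_dS2 LD); rewrite /= !evE. Qed.
Lemma ev_weight2 : (p%:R - 1) ^+ 2 * b * c - (p%:R ^+ 2 * a2 - a) =
  - (2 * (p%:R - 1) * (b * c - 4 * t * b' * c - 3 * t * b * c')).
Proof. by have := congr1 (fun F => ev F t) (ld_weight2 LD); rewrite /= !evE. Qed.

(** Logarithmic differentiation of t Q^3 = [dl] b a^3 gives w - R/Q = w t (b'/b + 3 a'/a), and
    [ld_dA] evaluates the bracket, leaving R/Q = w s / (b a). *)
Lemma qD_t : exists w : A_, [/\ qD t = t * w, w 0%N = 1 & Q * w * s = R * b * a].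
Proof.
have [[P0 Q0 R0] [_ DQ _]] := PQR.
have [[b0 c0 a0] [s0 a20 s20]] := ev_level0.
have tn : t != 0 by apply: (@ps_neq0 _ _ 1); rewrite t1 oner_neq0.
have dn : dl != 0 by apply: (@ps_neq0 _ _ 1); rewrite dl1 oner_neq0.
have an : a != 0 by apply: (@ps_neq0 _ _ 0); rewrite a0 oner_neq0.
have Qn : Q != 0 by apply: (@ps_neq0 _ _ 0); rewrite Q0 oner_neq0.
have [u tu] := ps_factorX t0.
have u0 : u 0%N = 1 by rewrite -t1 tu psXM.
have uu : u \is a GRing.unit by rewrite ps_unitE u0 oner_neq0.
pose w := (u + qD u) / u.
have uw : u * w = u + qD u by rewrite /w mulrC divrK.
have Dt : qD t = t * w.
  by rewrite tu -mulrA uw qDM -[ps_X _]expr1 qD_X expr1 mul1r mulrDr.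
exists w; split=> //.
  have := congr1 (fun f => coefs f 0) uw; rewrite psM0 psD u0 mul1r => ->.
  by rewrite /= mul0r addr0.
have D := congr1 (@qD _) tQ; move: D.
rewrite (qDM t) (qDM dl) (qDM (ev B t)) !qDX !qD_ev (qD_disc dlE) Dt /= -/b -/a -/b' -/a' => D.
apply: (mulfI (mulf_neq0 (expf_neq0 2 an) dn)).
apply: (lincomb4 (c := Q) (c' := - (t * Q ^+ 3)) (c'' := a ^+ 2 * dl * Q * w)
  (d := - (Q * w + P * Q - R)) D DQ ev_dA tQ).
rewrite -/a -/b; ring.
Qed.

Lemma level_nz : [/\ t != 0, dl != 0, Q != 0, a != 0 & s != 0] /\ [/\ b != 0 & c != 0].
Proof.
have [[P0 Q0 R0] _] := PQR; have [[b0 c0 a0] [s0 _ _]] := ev_level0.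
split; split; solve [by apply: (@ps_neq0 _ _ 0); rewrite (b0, c0, a0, s0, Q0) oner_neq0
  | by apply: (@ps_neq0 _ _ 1); rewrite (t1, dl1) oner_neq0].
Qed.

Section Weight2.
Variable w : A_.
Hypothesis Dt : qD t = t * w.
Hypothesis w0 : w 0%N = 1.
Hypothesis Qw : Q * w * s = R * b * a.

Let w_neq0 : w != 0. Proof. by apply: (@ps_neq0 _ _ 0); rewrite w0 oner_neq0. Qed.

(** This is j - m = C S^2 / t. *)
Lemma tR : t * R ^+ 2 = dl * c * s ^+ 2.
Proof. by apply: (lincomb3 (c := 1) (c' := t) (c'' := dl) tQ dlE ev_disc); rewrite -/a -/b; ring. Qed.

Lemma weight4 : Q * b * c = w ^+ 2 * a.
Proof.
have [[tn dn Qn an sn] [bn cn]] := level_nz.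
apply: (mulfI (mulf_neq0 (mulf_neq0 (expf_neq0 2 sn) tn) (expf_neq0 2 Qn))).
apply: (lincomb3 (c := s ^+ 2 * b * c) (c' := - (a * t * (Q * w * s + R * b * a)))
  (c'' := - (a ^+ 3 * b ^+ 2)) tQ Qw tR).
rewrite -/a -/b; ring.
Qed.

Lemma weight12 : dl * b ^+ 4 * c ^+ 3 = w ^+ 6 * t.
Proof.
have [[tn dn Qn an sn] [bn cn]] := level_nz.
apply: (mulfI (expf_neq0 3 an)).
apply: (lincomb2 (c := - (b ^+ 3 * c ^+ 3)) (c' := t * ((Q * b * c) ^+ 2 + Q * b * c * (w ^+ 2 * a)
  + (w ^+ 2 * a) ^+ 2)) tQ weight4); rewrite -/a -/b; ring.
Qed.

(** Logarithmic differentiation of [weight12]. *)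
Lemma qD_w : 6 * b * c * qD w =
  w * (P * b * c - w * (b * c - 4 * t * b' * c - 3 * t * b * c')).
Proof.
have [[tn dn Qn an sn] [bn cn]] := level_nz.
have D := congr1 (@qD _) weight12; move: D.
rewrite (qDM (dl * _)) (qDM dl) (qDM (w ^+ 6)) !qDX !qD_ev (qD_disc dlE) Dt /= -/b -/c -/c' -/b' => D.
apply: (mulfI (mulf_neq0 (expf_neq0 5 w_neq0) tn)).
apply: (lincomb2 (c := - (b * c))
  (c' := P * b * c + w * t * (4 * b' * c + 3 * b * c')) D weight12).
ring.
Qed.

Let p_neq0 : p%:R != 0 :> rat. Proof. by rewrite pnatr_eq0; case: (p) p_gt1. Qed.
Let ps_p_neq0 : p%:R != 0 :> A_.
Proof. by case: (p) p_gt1 => // n _; apply: ps_nat_neq0. Qed.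

(** Once [qD_w] is known, each differential equation comes down to one identity of the level:
    [ld_weight2] for P2, [ld_dA2] for Q2 and [ld_dS2] for R2. *)
Lemma level_p_ramanujan : exists P2 Q2 R2 : A_, [/\ ramanujan p P2 Q2 R2,
  p%:R * P2 = P + (p%:R - 1) * w, Q2 * b * c = w ^+ 2 * a2 & R2 * b ^+ 2 * c = w ^+ 3 * s2].
Proof.
have [[P0 Q0 R0] [DP DQ DR]] := PQR.
have [[b0 c0 a0] [s0 a20 s20]] := ev_level0.
have [[tn dn Qn an sn] [bn cn]] := level_nz.
have ubc : b * c \is a GRing.unit by rewrite ps_unitE psM0 b0 c0 mulr1 oner_neq0.
have ub2c : b ^+ 2 * c \is a GRing.unit.
  by rewrite ps_unitE psM0 psX0 b0 c0 expr1n mulr1 oner_neq0.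
pose P2 : A_ := ps_const (p%:R^-1) * (P + (p%:R - 1) * w).
pose Q2 := w ^+ 2 * a2 / (b * c); pose R2 := w ^+ 3 * s2 / (b ^+ 2 * c).
have P2E : p%:R * P2 = P + (p%:R - 1) * w.
  by rewrite -{1}(rmorph_nat (@ps_const rat) p) /P2 mulrA -rmorphM divff // rmorph1 mul1r.
have Q2E : Q2 * b * c = w ^+ 2 * a2 by rewrite -mulrA divrK.
have R2E : R2 * b ^+ 2 * c = w ^+ 3 * s2 by rewrite -mulrA divrK.
have DP2 : p%:R * qD P2 = qD P + (p%:R - 1) * qD w.
  have := congr1 (@qD _) P2E; rewrite (qDM p%:R) qDD (qDM (p%:R - 1)) qDD qDN qD1 qD_nat.
  by rewrite subr0 !mul0r !add0r.
exists P2, Q2, R2; split=> //; split; split.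
- rewrite psCM psD psM0 psB -(rmorph_nat (@ps_const rat)) /= P0 w0; field.
  exact: p_neq0.
- by have := congr1 (fun f => coefs f 0) Q2E; rewrite !psM0 ?psX0 w0 b0 c0 a20 ?expr1n !mulr1.
- by have := congr1 (fun f => coefs f 0) R2E; rewrite !psM0 ?psX0 w0 b0 c0 s20 ?expr1n !mulr1.
- have -> : p%:R * (P2 ^+ 2 - Q2) = p%:R * P2 ^+ 2 - p%:R * Q2 by ring.
  apply: (mulfI (mulf_neq0 (mulf_neq0 bn cn) ps_p_neq0)).
  have P2E2 : p%:R * P2 * (p%:R * P2) = (P + (p%:R - 1) * w) ^+ 2 by rewrite P2E expr2.
  have {}DP2 : 12 * (p%:R * qD P2) = 12 * qD P + 12 * ((p%:R - 1) * qD w) by rewrite DP2 mulrDr.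
  rewrite DP in DP2.
  apply: (lincomb6 (c1 := b * c) (c2 := - (b * c)) (c3 := 2 * (p%:R - 1)) (c4 := p%:R ^+ 2) (c5 := -1)
    (c6 := - w ^+ 2) DP2 P2E2 qD_w Q2E weight4 ev_weight2).
  rewrite -/a -/b -/c -/b' -/c' -/a2; ring.
- have D := congr1 (@qD _) Q2E; move: D.
  rewrite (qDM (Q2 * b)) (qDM Q2) (qDM (w ^+ 2)) !qDX !qD_ev Dt /= -/b -/c -/c' -/b' -/a2' -/a2 => D.
  apply: (mulfI (mulf_neq0 (expf_neq0 2 bn) (expf_neq0 2 cn))).
  apply: (lincomb6 (c1 := 3 * b * c) (c2 := w * a2)
    (c3 := - 3 * t * w * (b' * c + b * c') - b * c * (P + (p%:R - 1) * w))
    (c4 := p%:R * c) (c5 := w ^+ 3 * c) (c6 := - (b ^+ 2 * c ^+ 2 * Q2))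
    D qD_w Q2E R2E ev_dA2 P2E).
  rewrite -/b; ring.
- have D := congr1 (@qD _) R2E; move: D.
  rewrite (qDM (R2 * b ^+ 2)) (qDM R2) (qDM (w ^+ 3)) !qDX !qD_ev Dt /= -/b -/c -/c' -/b' -/s2'
    -/s2 => D.
  apply: (mulfI (mulf_neq0 (expf_neq0 3 bn) (expf_neq0 2 cn))).
  apply: (lincomb6 (c1 := 2 * b * c) (c2 := w ^+ 2 * s2)
    (c3 := - 2 * t * w * (2 * b' * c + b * c') - b * c * (P + (p%:R - 1) * w))
    (c4 := p%:R * b * (Q2 * b * c + w ^+ 2 * a2)) (c5 := w ^+ 4 * b) (c6 := - (b ^+ 3 * c ^+ 2 * R2))
    D qD_w R2E Q2E ev_dS2 P2E).
  rewrite -/b; ring.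
Qed.
End Weight2.
End Hauptmodul.

Let p_gt0 : (0 < p)%N. Proof. exact: ltnW. Qed.

Lemma ramanujan_qpow : ramanujan p (qpow p P) (qpow p Q) (qpow p R).
Proof.
have [[P0 Q0 R0] [DP DQ DR]] := PQR.
split; first by rewrite !qpow0.
rewrite !qD_qpow //; split; rewrite mulrCA; congr (_ * _).
- by rewrite -(rmorph_nat (qpow p)) -rmorphM DP mul1r rmorphB rmorphXn.
- by rewrite -(rmorph_nat (qpow p)) -rmorphM DQ mul1r rmorphB rmorphM.
- by rewrite -(rmorph_nat (qpow p)) -rmorphM DR mul1r rmorphB rmorphM rmorphXn.
Qed.

Lemma hauptmodul_modular : exists t : A_, [/\ t 0%N = 0, t 1%N = 1,
  (p%:R - 1) * qD t = t * (p%:R * qpow p P - P) &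
  qpow p t * (ev B t * ev A2 t ^+ 3) = t ^+ p * (ev B (qpow p t) * ev A (qpow p t) ^+ 3)].
Proof.
have [t [dl [t0 t1 dlE [dl0 dl1] tQ]]] := hauptmodul_exists.
have [w [Dt w0 Qw]] := qD_t t0 t1 dlE dl1 tQ.
have [P2 [Q2 [R2 [PQR2 P2E Q2E R2E]]]] := level_p_ramanujan t0 t1 dlE dl1 tQ Dt w0 Qw.
have [[tn dn Qn an sn] [bn cn]] := level_nz t0 t1 dl1.
have W12 := weight12 t0 t1 dlE dl1 tQ Qw.
have disc2 := ev_disc2 t.
have tp : t ^+ p = t ^+ p.-1 * t by rewrite -exprSr prednK.
have D2 : Q2 ^+ 3 - R2 ^+ 2 = m%:R * (dl * t ^+ p.-1).
  rewrite tp in disc2; apply: (mulfI (mulf_neq0 (expf_neq0 4 bn) (expf_neq0 3 cn))).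
  apply: (lincomb4 (c := ev B t * ((Q2 * ev B t * ev C t) ^+ 2
      + (Q2 * ev B t * ev C t) * (w ^+ 2 * ev A2 t) + (w ^+ 2 * ev A2 t) ^+ 2))
    (c' := - ev C t * (R2 * ev B t ^+ 2 * ev C t + w ^+ 3 * ev S2 t))
    (c'' := w ^+ 6) (d := - m%:R * t ^+ p.-1) Q2E R2E disc2 W12).
  ring.
(* The hypothesis of [ramanujan_inj] on the discriminants: both have coefficient m at q^p. *)
have dt : (dl * t ^+ p.-1) p = 1.
  have [u tu] := ps_factorX t0; have [u' du] := ps_factorX dl0.
  have u0 : u 0%N = 1 by rewrite -t1 tu psXM.
  have u0' : u' 0%N = 1 by rewrite -dl1 du psXM.
  rewrite tu du exprMn mulrACA -exprS prednK // psXnM leqnn subnn psM0 psX0 u0 u0'.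
  by rewrite expr1n mulr1.
have [PE QE RE] : [/\ P2 = qpow p P, Q2 = qpow p Q & R2 = qpow p R].
  apply: (ramanujan_inj p_gt0 PQR2 ramanujan_qpow).
  rewrite D2 -!rmorphXn -rmorphB qpow_p // disc1.
  by rewrite -(rmorph_nat (@ps_const rat)) psCM dt mulr1.
exists t; split=> //.
  by rewrite -PE P2E Dt; ring.
have sdl : qpow p dl = dl * t ^+ p.-1.
  apply: (mulfI ps_m_neq0); rewrite -D2 QE RE -!rmorphXn -rmorphB -dlE.
  by rewrite rmorphM rmorph_nat.
(* [E] and [F] express j(q^p) through t(q^p) and through t; eliminating Q2^3 gives the modular
   equation. *)
have E : qpow p t * Q2 ^+ 3 = dl * t ^+ p.-1 * (ev B (qpow p t) * ev A (qpow p t) ^+ 3).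
  move/(congr1 (qpow p)): tQ; rewrite rmorphM rmorphXn /= -QE => ->.
  by rewrite rmorphM /= sdl rmorphM rmorphXn /= !ev_rmorph.
have F : dl * t ^+ p.-1 * (ev B t * ev A2 t ^+ 3) = t ^+ p * Q2 ^+ 3.
  rewrite tp; apply: (mulfI (mulf_neq0 (expf_neq0 3 bn) (expf_neq0 3 cn))).
  apply: (lincomb2 (c := ev A2 t ^+ 3 * t ^+ p.-1) (c' := - (t ^+ p.-1 * t *
    ((Q2 * ev B t * ev C t) ^+ 2 + (Q2 * ev B t * ev C t) * (w ^+ 2 * ev A2 t)
      + (w ^+ 2 * ev A2 t) ^+ 2))) W12 Q2E).
  ring.
apply: (mulfI (mulf_neq0 dn (expf_neq0 p.-1 tn))).
by apply: (lincomb2 (c := qpow p t) (c' := t ^+ p) F E); ring.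
Qed.
End Level.

(** * Convolutions of divisor sums *)

Lemma sum_pick N i0 (F : nat -> rat) : (i0 < N)%N ->
  \sum_(0 <= i < N) (i == i0)%:R * F i = F i0.
Proof.
move=> iN; rewrite (bigD1_seq i0) ?mem_index_iota ?iota_uniq //= eqxx mul1r.
by rewrite big1 ?addr0 // => i /negbTE ->; rewrite mul0r.
Qed.

(** The substitution a -> a + b in a truncated sum; nothing is lost because G vanishes beyond the
    range. *)
Lemma sum_shift N b (G : nat -> rat) : (forall a, (N <= a)%N -> G a = 0) ->
  \sum_(0 <= a < N) (b < a)%:R * G a = \sum_(0 <= a < N) (0 < a)%:R * G (a + b)%N.
Proof.
move=> G0; transitivity (\sum_(0 <= a < b + N) (b < a)%:R * G a).
  rewrite [RHS](@big_cat_nat _ _ _ N) //=; last exact: leq_addl.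
  rewrite [X in _ + X]big_nat_cond [X in _ + X]big1 ?addr0 // => i /andP[/andP[Ni _] _].
  by rewrite G0 ?mulr0.
rewrite (@big_cat_nat _ _ _ b) //=; last exact: leq_addr.
rewrite big_nat_cond big1 ?add0r => [|i /andP[/andP[_ ib] _]]; last first.
  by rewrite ltnNge (ltnW ib) mul0r.
rewrite -{1}[b]add0n big_addn addKn; apply: eq_bigr => i _.
by rewrite -{1}[b]add0n ltn_add2r.
Qed.

Section LiouvilleSum.
Variable n : nat.
Hypothesis n_gt0 : (0 < n)%N.
Let N := n.+1.

(** The positive solutions of a x + b y = n all lie in this box. Summing over the whole box with a
    0/1 weight reduces rearrangements to exchanges of sums. *)
Definition sum4 (G : nat -> nat -> nat -> nat -> rat) :=
  \sum_(0 <= a < N) \sum_(0 <= b < N) \sum_(0 <= x < N) \sum_(0 <= y < N) G a b x y.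

Lemma sum4_swap12 G : sum4 G = sum4 (fun a b x y => G b a x y).
Proof. exact: exchange_big. Qed.
Lemma sum4_swap23 G : sum4 G = sum4 (fun a b x y => G a x b y).
Proof. by apply: eq_bigr => a _; apply: exchange_big. Qed.
Lemma sum4_swap34 G : sum4 G = sum4 (fun a b x y => G a b y x).
Proof. by do 2!apply: eq_bigr => ? _; apply: exchange_big. Qed.
Lemma eq_sum4 G H : (forall a b x y, G a b x y = H a b x y) -> sum4 G = sum4 H.
Proof. by move=> e; do 4!apply: eq_bigr => ? _. Qed.
Lemma sum4D G H : sum4 G + sum4 H = sum4 (fun a b x y => G a b x y + H a b x y).
Proof. by rewrite /sum4; do 4!(rewrite -big_split; apply: eq_bigr => ? _). Qed.

Definition wt a b x y : bool :=
  [&& 0 < a, 0 < b, 0 < x, 0 < y & a * x + b * y == n]%N.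

Lemma sum4_swap (F : rat -> rat -> rat) (c : nat -> nat -> nat -> nat -> bool) :
  sum4 (fun a b x y => (wt a b x y && c a b x y)%:R * F a%:R b%:R) =
  sum4 (fun a b x y => (wt a b x y && c b a y x)%:R * F b%:R a%:R).
Proof.
rewrite sum4_swap12 sum4_swap34; apply: eq_sum4 => a b x y.
by rewrite (_ : wt b a y x = wt a b x y) // /wt; apply/idP/idP; lia.
Qed.

(* (a, b, x, y) -> (a - b, b, x, x + y) maps the solutions with a > b onto those with x < y. *)
Lemma sum4_shear (F : rat -> rat -> rat) :
  sum4 (fun a b x y => (wt a b x y && (b < a)%N)%:R * F (a%:R - b%:R) b%:R) =
  sum4 (fun a b x y => (wt a b x y && (x < y)%N)%:R * F a%:R b%:R).
Proof.
rewrite sum4_swap12 sum4_swap23 [RHS]sum4_swap12 [RHS]sum4_swap23.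
apply: eq_bigr => b _; apply: eq_bigr => x _.
pose G a := \sum_(0 <= y < N) (wt a b x y)%:R * F (a%:R - b%:R) b%:R.
transitivity (\sum_(0 <= a < N) (b < a)%:R * G a).
  apply: eq_bigr => a _; rewrite /G big_distrr; apply: eq_bigr => y _ /=.
  by rewrite mulrA -natrM mulnb andbC.
rewrite sum_shift => [|a Na]; last first.
  rewrite /G big1 // => y _; rewrite (_ : wt _ _ _ _ = false) ?mul0r //.
  by apply/negbTE/negP; rewrite /wt /N in Na *; nia.
apply: eq_bigr => a _; rewrite /G big_distrr /=.
pose H y := ([&& 0 < a, 0 < b, 0 < x & a * x + b * y == n]%N)%:R * F a%:R b%:R.
transitivity (\sum_(0 <= y < N) (0 < y)%:R * H (y + x)%N).
  apply: eq_bigr => y _; rewrite natrD addrK /H !mulrA -!natrM !mulnb; congr ((nat_of_bool _)%:R * _).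
  by rewrite /wt; apply/idP/idP; lia.
rewrite -sum_shift => [|y Ny]; last first.
  rewrite /H (_ : [&& _, _, _ & _] = false) ?mul0r //.
  by apply/negbTE/negP; rewrite /N in Ny; nia.
apply: eq_bigr => y _; rewrite /H mulrA -natrM mulnb; congr ((nat_of_bool _)%:R * _).
by rewrite /wt; apply/idP/idP; lia.
Qed.

Lemma sum4_trichotomy (F : rat -> rat -> rat) (u v : nat -> nat -> nat -> nat -> nat) :
  sum4 (fun a b x y => (wt a b x y)%:R * F a%:R b%:R) =
  sum4 (fun a b x y => (wt a b x y && (u a b x y < v a b x y)%N)%:R * F a%:R b%:R) +
  sum4 (fun a b x y => (wt a b x y && (v a b x y < u a b x y)%N)%:R * F a%:R b%:R) +
  sum4 (fun a b x y => (wt a b x y && (u a b x y == v a b x y))%:R * F a%:R b%:R).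
Proof.
rewrite !sum4D; apply: eq_sum4 => a b x y; rewrite -!mulrDl -!natrD; congr (_%:R * _).
by case: ltngtP; rewrite ?andbT ?andbF ?addn0.
Qed.

(** The first sum is split by comparing x with y, the second by comparing a with b. The two
    symmetries of f fold the halves of each together, and the shear matches what remains off the
    diagonals. *)
Lemma sum4_reduce (f : rat -> rat -> rat) :
  (forall u v, f u v = f v u) -> (forall u v, f (u - v) v = f (v - u) u) ->
  sum4 (fun a b x y => (wt a b x y)%:R * (f a%:R b%:R - f (a%:R - b%:R) b%:R)) =
  sum4 (fun a b x y => (wt a b x y && (x == y))%:R * f a%:R b%:R) -
  sum4 (fun a b x y => (wt a b x y && (a == b))%:R * f 0 b%:R).
Proof.
move=> fC fS.
have e1 := sum4_trichotomy f (fun a b x y => x) (fun a b x y => y).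
have e2 := sum4_trichotomy (fun u v => f (u - v) v) (fun a b x y => a) (fun a b x y => b).
rewrite (sum4_swap f (fun a b x y => y < x)%N) -(sum4_shear f) in e1.
rewrite (sum4_swap (fun u v => f (u - v) v) (fun a b x y => a < b)%N) in e2.
have e3 : sum4 (fun a b x y => (wt a b x y && (x < y)%N)%:R * f b%:R a%:R) =
  sum4 (fun a b x y => (wt a b x y && (b < a)%N)%:R * f (a%:R - b%:R) b%:R).
  by rewrite sum4_shear; apply: eq_sum4 => a b x y; rewrite fC.
have e4 : sum4 (fun a b x y => (wt a b x y && (b < a)%N)%:R * f (b%:R - a%:R) a%:R) =
  sum4 (fun a b x y => (wt a b x y && (b < a)%N)%:R * f (a%:R - b%:R) b%:R).
  by apply: eq_sum4 => a b x y; rewrite fS.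
have e5 : sum4 (fun a b x y => (wt a b x y && (a == b))%:R * f (a%:R - b%:R) b%:R) =
  sum4 (fun a b x y => (wt a b x y && (a == b))%:R * f 0 b%:R).
  by apply: eq_sum4 => a b x y; case: eqP => [->|]; rewrite ?subrr // andbF !mul0r.
rewrite e3 in e1; rewrite e4 e5 in e2.
have -> : sum4 (fun a b x y => (wt a b x y)%:R * (f a%:R b%:R - f (a%:R - b%:R) b%:R)) =
  sum4 (fun a b x y => (wt a b x y)%:R * f a%:R b%:R) -
  sum4 (fun a b x y => (wt a b x y)%:R * f (a%:R - b%:R) b%:R).
  apply/eqP; rewrite eq_sym subr_eq sum4D; apply/eqP/eq_sum4 => a b x y.
  by rewrite -mulrDr subrK.
rewrite e1 e2; ring.
Qed.


Lemma pick_quotient a (F : nat -> rat) : (0 < a)%N ->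
  \sum_(0 <= x < N) (a * x == n)%:R * F x = (a %| n)%N%:R * F (n %/ a)%N.
Proof.
move=> a0; case: (boolP (a %| n)%N) => [/dvdnP[e nE]|nd].
  rewrite -(@sum_pick N (n %/ a)%N F) ?mul1r; last by rewrite ltnS leq_div.
  by apply: eq_bigr => x _; rewrite nE mulnK // [(e * a)%N]mulnC eqn_pmul2l.
rewrite mul0r big1 // => x _; case: eqP => [e|]; last by rewrite mul0r.
by rewrite -e dvdn_mulr in nd.
Qed.


(** With x = y the equation is (a + b) x = n, and d = a + b. *)
Lemma sum4_diagx (F : rat -> rat -> rat) :
  sum4 (fun a b x y => (wt a b x y && (x == y))%:R * F a%:R b%:R) =
  \sum_(0 <= d < N) (d %| n)%N%:R * \sum_(0 <= a < d) (0 < a)%N%:R * F a%:R (d%:R - a%:R).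
Proof.
pose H a d := ((0 < a) && (d %| n))%N%:R * F a%:R (d%:R - a%:R).
transitivity (\sum_(0 <= a < N) \sum_(0 <= d < N) (a < d)%N%:R * H a d).
  apply: eq_bigr => a _; rewrite sum_shift => [|d Nd]; last first.
    by rewrite /H gtnNdvd ?andbF ?mul0r.
  apply: eq_bigr => b _; rewrite /H natrD addrK.
  have Z : ~~ ((0 < a) && (0 < b))%N ->
      \sum_(0 <= x < N) \sum_(0 <= y < N) (wt a b x y && (x == y))%:R * F a%:R b%:R = 0.
    move=> ab; rewrite big1 // => x _; rewrite big1 // => y _.
    by rewrite (_ : _ && _ = false) ?mul0r //; apply/negbTE/negP; rewrite /wt; lia.
  case: (posnP a) => [a0|a0]; first by rewrite mul0r mulr0 Z // a0.
  case: (posnP b) => [b0|b0]; first by rewrite mul0r Z // b0 andbF.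
  rewrite mul1r /=.
  rewrite addnC -(@pick_quotient _ (fun=> F a%:R b%:R)) ?addn_gt0 ?a0 //.
  apply: eq_big_nat => x xN.
  rewrite -(@sum_pick N x (fun y => ((a + b) * x == n)%N%:R * F a%:R b%:R)) //.
  apply: eq_bigr => y _; rewrite mulrA -natrM mulnb; congr ((nat_of_bool _)%:R * _).
  by rewrite /wt; apply/idP/idP; lia.
rewrite exchange_big; apply: eq_big_nat => d /andP[_ dN] /=.
rewrite (@big_cat_nat _ _ _ d) //=; last exact: ltnW.
rewrite [X in _ + X]big_nat_cond [X in _ + X]big1 ?addr0 => [|i /andP[/andP[di _] _]]; last first.
  by rewrite ltnNge di mul0r.
rewrite big_distrr /=; apply: eq_big_nat => a /andP[_ ->].
by rewrite mul1r /H !mulrA -natrM mulnb andbC.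
Qed.

(** With a = b the equation is a (x + y) = n, and x + y = n / a has n / a - 1 positive solutions. *)
Lemma sum4_diaga (F : rat -> rat) :
  sum4 (fun a b x y => (wt a b x y && (a == b))%:R * F b%:R) =
  \sum_(0 <= d < N) (d %| n)%N%:R * (((n %/ d)%N.-1)%:R * F d%:R).
Proof.
apply: eq_big_nat => a aN.
transitivity (\sum_(0 <= x < N) \sum_(0 <= y < N)
    ([&& 0 < a, 0 < x, 0 < y & a * (x + y) == n]%N)%:R * F a%:R).
  rewrite exchange_big; apply: eq_bigr => x _; rewrite exchange_big; apply: eq_bigr => y _.
  rewrite -(@sum_pick N a (fun b => ([&& 0 < a, 0 < x, 0 < y & a * (x + y) == n]%N)%:R * F b%:R)) //.
  apply: eq_bigr => b _; rewrite mulrA -natrM mulnb; congr ((nat_of_bool _)%:R * _).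
  by rewrite /wt; apply/idP/idP; nia.
have [a0|a0] := posnP a.
  transitivity (0 : rat); last by rewrite a0 dvd0n gtn_eqF // mul0r.
  by rewrite a0 big1 // => x _; rewrite big1 // => y _; rewrite mul0r.
transitivity (\sum_(0 <= x < N) \sum_(0 <= e < N)
  (x < e)%N%:R * (((0 < x) && (a * e == n))%N%:R * F a%:R)).
  apply: eq_bigr => x _; rewrite sum_shift => [|e Ne].
    apply: eq_bigr => y _; rewrite mulrA -natrM mulnb; congr ((nat_of_bool _)%:R * _).
    by apply/idP/idP; lia.
  rewrite (_ : _ && _ = false) ?mul0r //; apply/negbTE/negP; rewrite /N in Ne; nia.
rewrite exchange_big -(@pick_quotient a (fun e => e.-1%:R * F a%:R)) //=.
apply: eq_big_nat => e /andP[_ eN].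
have -> : (e.-1)%:R = \sum_(0 <= x < N) ((0 < x) && (x < e))%N%:R :> rat.
  rewrite -natr_sum; congr _%:R; rewrite (@big_cat_nat _ _ _ e) //=; last exact: ltnW.
  rewrite [X in (_ + X)%N]big_nat_cond [X in (_ + X)%N]big1
    ?addn0 => [|i /andP[/andP[ei _] _]]; last first.
    by rewrite (leq_gtF ei) andbF.
  case: e eN => [|e] eN; first by rewrite big_nil.
  rewrite big_nat_recl // add0n /= -[RHS]addn0; under eq_big_nat => i /andP[_ ie] do rewrite ltnS ie.
  by rewrite sum_nat_const_nat subn0 muln1 addn0.
rewrite big_distrl big_distrr /=; apply: eq_bigr => x _.
by rewrite !mulrA -!natrM !mulnb; congr ((nat_of_bool _)%:R * _); apply/idP/idP; lia.
Qed.
End LiouvilleSum.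

(** The range is empty for n = 0, so the end terms of the convolutions vanish. *)
Definition sig k n : rat := \sum_(1 <= a < n.+1 | (a %| n)%N) a%:R ^+ k.

Lemma sigE N k m : (m < N)%N -> sig k m =
  \sum_(0 <= a < N) \sum_(0 <= x < N) ([&& 0 < a, 0 < x & a * x == m]%N)%:R * a%:R ^+ k.
Proof.
move=> mN; have [->|m0] := posnP m.
  rewrite /sig big_geq // big1 // => a _; rewrite big1 // => x _.
  rewrite (_ : [&& _, _ & _] = false) ?mul0r //; apply/negbTE/negP; nia.
transitivity (\sum_(0 <= a < N) ((0 < a) && (a %| m))%N%:R * a%:R ^+ k : rat).
  rewrite (@big_cat_nat _ _ _ m.+1) //= [X in _ + X]big_nat_cond [X in _ + X]big1 ?addr0.
    rewrite big_nat_recl //= mul0r add0r /sig big_add1 /= big_mkcond /=.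
    by apply: eq_bigr => i _; case: ifP; rewrite ?mul1r ?mul0r.
  by move=> i /andP[/andP[mi _] _]; rewrite gtnNdvd ?andbF ?mul0r.
apply: eq_bigr => a _; have [->|a0] := posnP a => /=.
  by rewrite mul0r big1 // => x _; rewrite mul0r.
rewrite [RHS](@big_cat_nat _ _ _ m.+1) //= [X in _ + X]big_nat_cond [X in _ + X]big1 ?addr0.
  rewrite -(@pick_quotient m a (fun=> a%:R ^+ k)) //; apply: eq_bigr => x _.
  by congr ((nat_of_bool _)%:R * _); apply/idP/idP; nia.
move=> i /andP[/andP[mi _] _].
by rewrite (_ : _ && _ = false) ?mul0r //; apply/negbTE/negP; nia.
Qed.

(** The solutions are sorted by the value m = a x. *)
Lemma sum4_conv n i j : 
  sum4 n (fun a b x y => (wt n a b x y)%:R * (a%:R ^+ i * b%:R ^+ j)) =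
  \sum_(m < n.+1) sig i m * sig j (n - m)%N.
Proof.
rewrite -(big_mkord xpredT (fun m => sig i m * sig j (n - m)%N)).
set N := n.+1.
transitivity (\sum_(0 <= m < N) \sum_(0 <= a < N) \sum_(0 <= x < N) \sum_(0 <= b < N)
   \sum_(0 <= y < N) ([&& 0 < a, 0 < x & a * x == m]%N)%:R * a%:R ^+ i *
   (([&& 0 < b, 0 < y & b * y == n - m]%N)%:R * b%:R ^+ j) : rat); last first.
  apply: eq_big_nat => m /andP[_ mN]; rewrite (sigE i mN) (@sigE N j (n - m)) ?ltnS ?leq_subr //.
  rewrite big_distrl; apply: eq_bigr => a _ /=.
  rewrite big_distrl; apply: eq_bigr => x _ /=.
  rewrite big_distrr; apply: eq_bigr => b _ /=.
  by rewrite big_distrr.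
rewrite [RHS]exchange_big sum4_swap23; apply: eq_bigr => a _.
rewrite [RHS]exchange_big; apply: eq_bigr => x _.
rewrite [RHS]exchange_big; apply: eq_bigr => b _.
rewrite [RHS]exchange_big; apply: eq_bigr => y _ /=.
case: (ltnP (a * x) N) => axN.
  rewrite -(@sum_pick N (a * x)%N (fun m => (wt n a b x y)%:R * (a%:R ^+ i * b%:R ^+ j))) //.
  apply: eq_big_nat => m /andP[_ mN]; rewrite [RHS]mulrACA [LHS]mulrA -!natrM !mulnb.
  by congr ((nat_of_bool _)%:R * _); rewrite /wt; apply/idP/idP; rewrite /N in mN axN; lia.
rewrite (_ : wt _ _ _ _ _ = false); last first.
  by rewrite /wt; apply/negbTE/negP; rewrite /N in axN; lia.
rewrite mul0r big_nat_cond big1 // => m /andP[/andP[_ mN] _].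
by rewrite (_ : [&& 0 < a, _ & _]%N = false) ?mul0r //; apply/negbTE/negP; lia.
Qed.

(** The sum h includes a = 0, which the diagonal x = y does not; the extra f(0, d) turns the factor
    n/d - 1 of the diagonal a = b into n/d. *)
Lemma liouville n (f : rat -> rat -> rat) (h : rat -> rat) : (0 < n)%N ->
  (forall u v, f u v = f v u) -> (forall u v, f (u - v) v = f (v - u) u) ->
  (forall d : nat, \sum_(0 <= a < d) f a%:R (d%:R - a%:R) = h d%:R) ->
  sum4 n (fun a b x y => (wt n a b x y)%:R * (f a%:R b%:R - f (a%:R - b%:R) b%:R)) =
  \sum_(1 <= d < n.+1 | (d %| n)%N) (h d%:R - n%:R / d%:R * f 0 d%:R).
Proof.
move=> n0 fC fS fh; rewrite sum4_reduce // (sum4_diagx n0) (sum4_diaga n0 (f 0)) -sumrB.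
rewrite big_nat_recl // dvd0n (gtn_eqF n0) !mul0r subrr add0r.
rewrite [RHS]big_add1 [RHS]big_mkcond /=; apply: eq_bigr => d _.
case: ifP => [dn|]; last by rewrite !mul0r subrr.
rewrite !mul1r -fh big_nat_recl // [in RHS]big_nat_recl // mul0r add0r subr0.
under eq_bigr => i _ do rewrite ltn0Sn mul1r.
case/dvdnP: dn => e nE; have e0 : (0 < e)%N by move: n0; rewrite nE; case: (e).
have -> : n%:R / d.+1%:R = e%:R :> rat by rewrite nE natrM mulfK // pnatr_eq0.
have eE : e%:R = e.-1%:R + 1 :> rat by rewrite natr1 prednK.
rewrite nE mulnK // eE; ring.
Qed.

(** * Power sums of the test functions for Liouville's identity *)

Section PowerSums.
Variable R : comNzRingType.

(* Up to sign, the elementary symmetric functions of u, v, - u - v: polynomials in e2 and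
   e3^2 satisfy both hypotheses of [liouville]. *)
Definition e2 (u v : R) := u ^+ 2 + u * v + v ^+ 2.
Definition e3 (u v : R) := u * v * (u + v).

Lemma e2_sub u v : e2 (u - v) v = e2 (v - u) u. Proof. by rewrite /e2; ring. Qed.
Lemma e2C u v : e2 u v = e2 v u. Proof. by rewrite /e2; ring. Qed.
Lemma e3_sub u v : e3 (u - v) v ^+ 2 = e3 (v - u) u ^+ 2. Proof. by rewrite /e3; ring. Qed.
Lemma e3C u v : e3 u v = e3 v u. Proof. by rewrite /e3; ring. Qed.

(** The upper limit m is kept independent of D so that induction on m applies; the use is at D =
    m. *)
Lemma sum_e2 m (D : R) :
  6 * \sum_(0 <= a < m) e2 a%:R (D - a%:R) =
    m%:R + 3 * m%:R * D + 6 * m%:R * D ^+ 2 - 3 * m%:R ^+ 2 - 3 * m%:R ^+ 2 * D + 2 * m%:R ^+ 3.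
Proof.
elim: m => [|m IH]; first by rewrite (big_geq (leqnn 0)); ring.
rewrite (big_nat_recr _ _ _ (leq0n m)) mulrDr IH -natr1 /e2 /e3; ring.
Qed.

Lemma sum_e2_sqr m (D : R) :
  30 * \sum_(0 <= a < m) e2 a%:R (D - a%:R) ^+ 2 =
    - m%:R + 15 * m%:R * D ^+ 2 + 30 * m%:R * D ^+ 3 + 30 * m%:R * D ^+ 4 - 15 * m%:R ^+ 2 * D -
    45 * m%:R ^+ 2 * D ^+ 2 - 30 * m%:R ^+ 2 * D ^+ 3 + 10 * m%:R ^+ 3 + 30 * m%:R ^+ 3 * D + 30
    * m%:R ^+ 3 * D ^+ 2 - 15 * m%:R ^+ 4 - 15 * m%:R ^+ 4 * D + 6 * m%:R ^+ 5.
Proof.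
elim: m => [|m IH]; first by rewrite (big_geq (leqnn 0)); ring.
rewrite (big_nat_recr _ _ _ (leq0n m)) mulrDr IH -natr1 /e2 /e3; ring.
Qed.

Lemma sum_e2_cube m (D : R) :
  420 * \sum_(0 <= a < m) e2 a%:R (D - a%:R) ^+ 3 =
    10 * m%:R - 84 * m%:R * D ^+ 2 + 420 * m%:R * D ^+ 4 + 630 * m%:R * D ^+ 5 + 420 * m%:R * D
    ^+ 6 + 105 * m%:R ^+ 2 * D - 735 * m%:R ^+ 2 * D ^+ 3 - 1260 * m%:R ^+ 2 * D ^+ 4 - 630 *
    m%:R ^+ 2 * D ^+ 5 - 70 * m%:R ^+ 3 + 840 * m%:R ^+ 3 * D ^+ 2 + 1470 * m%:R ^+ 3 * D ^+ 3 +
    840 * m%:R ^+ 3 * D ^+ 4 - 525 * m%:R ^+ 4 * D - 1260 * m%:R ^+ 4 * D ^+ 2 - 735 * m%:R ^+ 4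
    * D ^+ 3 + 210 * m%:R ^+ 5 + 630 * m%:R ^+ 5 * D + 504 * m%:R ^+ 5 * D ^+ 2 - 210 * m%:R ^+
    6 - 210 * m%:R ^+ 6 * D + 60 * m%:R ^+ 7.
Proof.
elim: m => [|m IH]; first by rewrite (big_geq (leqnn 0)); ring.
rewrite (big_nat_recr _ _ _ (leq0n m)) mulrDr IH -natr1 /e2 /e3; ring.
Qed.

Lemma sum_e3_sqr m (D : R) :
  30 * \sum_(0 <= a < m) e3 a%:R (D - a%:R) ^+ 2 =
    - m%:R * D ^+ 2 + 5 * m%:R * D ^+ 4 - 15 * m%:R ^+ 2 * D ^+ 3 - 15 * m%:R ^+ 2 * D ^+ 4 + 10
    * m%:R ^+ 3 * D ^+ 2 + 30 * m%:R ^+ 3 * D ^+ 3 + 10 * m%:R ^+ 3 * D ^+ 4 - 15 * m%:R ^+ 4 *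
    D ^+ 2 - 15 * m%:R ^+ 4 * D ^+ 3 + 6 * m%:R ^+ 5 * D ^+ 2.
Proof.
elim: m => [|m IH]; first by rewrite (big_geq (leqnn 0)); ring.
rewrite (big_nat_recr _ _ _ (leq0n m)) mulrDr IH -natr1 /e2 /e3; ring.
Qed.

End PowerSums.
Arguments e2 {R} u v.
Arguments e3 {R} u v.

Section Convolutions.
Variable n : nat.
Hypothesis n_gt0 : (0 < n)%N.

Definition conv i j : rat := \sum_(m < n.+1) sig i m * sig j (n - m)%N.

Lemma convE i j (c : rat) :
  sum4 n (fun a b x y => (wt n a b x y)%:R * (c * (a%:R ^+ i * b%:R ^+ j))) = c * conv i j.
Proof.
rewrite /conv -sum4_conv /sum4; do 4![rewrite big_distrr /=; apply: eq_bigr => ? _].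
by rewrite mulrCA.
Qed.

Lemma conv_sym i j : conv i j = conv j i.
Proof.
rewrite -[LHS]mul1r -[RHS]mul1r -!convE sum4_swap12 sum4_swap34; apply: eq_sum4 => a b x y.
rewrite [_ ^+ i * _]mulrC (_ : wt n b a y x = wt n a b x y) //.
by rewrite /wt; apply/idP/idP; lia.
Qed.

Lemma sum_div_sig k : \sum_(1 <= d < n.+1 | (d %| n)%N) n%:R / d%:R * d%:R ^+ k.+1 =
  n%:R * sig k n :> rat.
Proof.
rewrite /sig big_distrr /= big_nat_cond [RHS]big_nat_cond.
apply: eq_bigr => d /andP[/andP[d0 _] _]; rewrite exprS; field.
by rewrite pnatr_eq0 -lt0n.
Qed.



Lemma liouville_sig f (c7 c5 c3 c1 e : rat) k :
  (forall u v, f u v = f v u) -> (forall u v, f (u - v) v = f (v - u) u) ->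
  (forall d : nat, \sum_(0 <= a < d) f a%:R (d%:R - a%:R) =
     c7 * d%:R ^+ 7 + c5 * d%:R ^+ 5 + c3 * d%:R ^+ 3 + c1 * d%:R ^+ 1) ->
  (forall d, f 0 d = e * d ^+ k.+1) ->
  sum4 n (fun a b x y => (wt n a b x y)%:R * (f a%:R b%:R - f (a%:R - b%:R) b%:R)) =
  c7 * sig 7 n + c5 * sig 5 n + c3 * sig 3 n + c1 * sig 1 n - e * (n%:R * sig k n).
Proof.
move=> fC fS fh f0; rewrite (@liouville n f
  (fun d => c7 * d ^+ 7 + c5 * d ^+ 5 + c3 * d ^+ 3 + c1 * d ^+ 1)) //.
rewrite -sum_div_sig /sig !mulr_sumr -!big_split -sumrB /=.
by apply: eq_bigr => d _; rewrite f0 [X in _ - X]mulrCA.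
Qed.

(** Passing from f(a, b) to f(a - b, b) changes a b into - a b in e2 = a^2 + a b + b^2 and a + b
    into a - b in e3. The differences for e2, e2^2, e3^2, e2^3 are therefore 2ab, 4ab(a^2 + b^2),
    4a^3b^3 and 6ab(a^4 + b^4) + 14a^3b^3, which produce the four convolutions. *)
Lemma conv11 : 12 * conv 1 1 = 5 * sig 3 n + sig 1 n - 6 * (n%:R * sig 1 n).
Proof.
have S (d : nat) : \sum_(0 <= a < d) e2 a%:R (d%:R - a%:R) = 0 * d%:R ^+ 7 + 0 * d%:R ^+ 5
    + 5 / 6 * d%:R ^+ 3 + 1 / 6 * d%:R ^+ 1 :> rat.
  by apply: (@mulfI _ 6) => //; rewrite sum_e2; field.
have f0 d : e2 0 d = 1 * d ^+ 2 :> rat by rewrite /e2; ring.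
have := liouville_sig (@e2C rat) (@e2_sub rat) S f0.
rewrite (_ : sum4 _ _ = 2 * conv 1 1); first by lra.
by rewrite -convE; apply: eq_sum4 => a b x y; congr (_ * _); rewrite /e2; ring.
Qed.

Lemma conv13 : 240 * conv 1 3 =
  21 * sig 5 n + 10 * sig 3 n - sig 1 n - 30 * (n%:R * sig 3 n).
Proof.
have fC (u v : rat) : e2 u v ^+ 2 = e2 v u ^+ 2 by rewrite e2C.
have fS (u v : rat) : e2 (u - v) v ^+ 2 = e2 (v - u) u ^+ 2 by rewrite e2_sub.
have S (d : nat) : \sum_(0 <= a < d) e2 a%:R (d%:R - a%:R) ^+ 2 = 0 * d%:R ^+ 7
    + 21 / 30 * d%:R ^+ 5 + 10 / 30 * d%:R ^+ 3 + - (1 / 30) * d%:R ^+ 1 :> rat.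
  by apply: (@mulfI _ 30) => //; rewrite sum_e2_sqr; field.
have f0 d : e2 0 d ^+ 2 = 1 * d ^+ 4 :> rat by rewrite /e2; ring.
have := liouville_sig fC fS S f0.
rewrite (_ : sum4 _ _ = 8 * conv 1 3); first by lra.
transitivity (4 * conv 1 3 + 4 * conv 3 1); last by rewrite (conv_sym 3); ring.
rewrite -!convE sum4D; apply: eq_sum4 => a b x y; rewrite -mulrDr; congr (_ * _).
by rewrite /e2; ring.
Qed.

Lemma conv33 : 120 * conv 3 3 = sig 7 n - sig 3 n.
Proof.
have fC (u v : rat) : e3 u v ^+ 2 = e3 v u ^+ 2 by rewrite e3C.
have S (d : nat) : \sum_(0 <= a < d) e3 a%:R (d%:R - a%:R) ^+ 2 = 1 / 30 * d%:R ^+ 7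
    + 0 * d%:R ^+ 5 + - (1 / 30) * d%:R ^+ 3 + 0 * d%:R ^+ 1 :> rat.
  by apply: (@mulfI _ 30) => //; rewrite sum_e3_sqr; field.
have f0 d : e3 0 d ^+ 2 = 0 * d ^+ 1 :> rat by rewrite /e3; ring.
have := liouville_sig fC (@e3_sub rat) S f0.
rewrite (_ : sum4 _ _ = 4 * conv 3 3); first by lra.
by rewrite -convE; apply: eq_sum4 => a b x y; congr (_ * _); rewrite /e3; ring.
Qed.

Lemma conv15 : 504 * conv 1 5 =
  20 * sig 7 n + 21 * sig 5 n + sig 1 n - 42 * (n%:R * sig 5 n).
Proof.
have fC (u v : rat) : e2 u v ^+ 3 = e2 v u ^+ 3 by rewrite e2C.
have fS (u v : rat) : e2 (u - v) v ^+ 3 = e2 (v - u) u ^+ 3 by rewrite e2_sub.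
have S (d : nat) : \sum_(0 <= a < d) e2 a%:R (d%:R - a%:R) ^+ 3 = 249 / 420 * d%:R ^+ 7
    + 210 / 420 * d%:R ^+ 5 + - (49 / 420) * d%:R ^+ 3 + 10 / 420 * d%:R ^+ 1 :> rat.
  by apply: (@mulfI _ 420); [rewrite pnatr_eq0|rewrite sum_e2_cube; field].
have f0 d : e2 0 d ^+ 3 = 1 * d ^+ 6 :> rat by rewrite /e2; ring.
have := liouville_sig fC fS S f0; have := conv33.
rewrite (_ : sum4 _ _ = 12 * conv 1 5 + 14 * conv 3 3); first by lra.
transitivity (6 * conv 1 5 + 6 * conv 5 1 + 14 * conv 3 3); last first.
  by rewrite (conv_sym 5); ring.
rewrite -!convE !sum4D; apply: eq_sum4 => a b x y; rewrite -!mulrDr; congr (_ * _).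
by rewrite /e2; ring.
Qed.
End Convolutions.

(** * Eisenstein series and Delta *)

Lemma psMnat (R : comNzRingType) m (f : pseries R) n : (m%:R * f) n = m%:R * f n.
Proof. by rewrite -(rmorph_nat (@ps_const R)) psCM. Qed.

Definition Sig k : pseries rat := PSeries (sig k).
Definition E2 : pseries rat := 1 - 24 * Sig 1.
Definition E4 : pseries rat := 1 + 240 * Sig 3.
Definition E6 : pseries rat := 1 - 504 * Sig 5.

Lemma sig0 k : sig k 0 = 0. Proof. by rewrite /sig big_geq. Qed.
Lemma sig1 k : sig k 1 = 1. Proof. by rewrite /sig big_mkcond big_nat1 expr1n. Qed.

Lemma Sig_conv i j n : (Sig i * Sig j) n = conv n i j. Proof. by []. Qed.
Lemma conv0 i j : conv 0 i j = 0. Proof. by rewrite /conv big_ord1 sig0 mul0r. Qed.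

Lemma Sig11 : 12 * (Sig 1 * Sig 1) = 5 * Sig 3 + Sig 1 - 6 * qD (Sig 1).
Proof.
apply: pseriesP => n; rewrite psB psD !psMnat Sig_conv.
case: n => [|n]; last by rewrite conv11.
by rewrite conv0 /= !sig0; ring.
Qed.

Lemma Sig13 : 240 * (Sig 1 * Sig 3) = 21 * Sig 5 + 10 * Sig 3 - Sig 1 - 30 * qD (Sig 3).
Proof.
apply: pseriesP => n; rewrite !psB psD !psMnat Sig_conv.
case: n => [|n]; last by rewrite conv13.
by rewrite conv0 /= !sig0; ring.
Qed.

Lemma Sig33 : 120 * (Sig 3 * Sig 3) = Sig 7 - Sig 3.
Proof.
apply: pseriesP => n; rewrite psB !psMnat Sig_conv.
case: n => [|n]; last by rewrite conv33.
by rewrite conv0 /= !sig0; ring.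
Qed.

Lemma Sig15 : 504 * (Sig 1 * Sig 5) = 20 * Sig 7 + 21 * Sig 5 + Sig 1 - 42 * qD (Sig 5).
Proof.
apply: pseriesP => n; rewrite psB !psD !psMnat Sig_conv.
case: n => [|n]; last by rewrite conv15.
by rewrite conv0 /= !sig0; ring.
Qed.

Lemma qD_natM m (f : pseries rat) : qD (m%:R * f) = m%:R * qD f.
Proof. by rewrite qDM qD_nat mul0r add0r. Qed.

Lemma eisenstein_ramanujan : ramanujan 1 E2 E4 E6.
Proof.
split; first by split; rewrite /E2 /E4 /E6 (psB, psD) psMnat ps1 /= sig0; ring.
rewrite /E2 /E4 /E6 !qDD !qDN !qD_natM qD1; split.
- by apply: (lincomb1 (c := - 48) Sig11); ring.
- by apply: (lincomb1 (c := 24) Sig13); ring.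
(* [Sig33], which amounts to E4^2 = E8, eliminates the divisor sums of exponent 7. *)
- by apply: (lincomb2 (c := - 24) (c' := 480) Sig15 Sig33); ring.
Qed.

Lemma psM1 (f g : pseries rat) : (f * g) 1%N = f 0%N * g 1%N + f 1%N * g 0%N.
Proof. by rewrite psM !big_ord_recl big_ord0 addr0. Qed.

Lemma eisenstein_disc : (E4 ^+ 3 - E6 ^+ 2) 1%N = 1728%:R.
Proof.
have [[_ Q0 R0] _] := eisenstein_ramanujan.
have one1 : (1 : pseries rat) 1%N = 0 by rewrite ps1.
rewrite psB !exprS expr0 !mulr1 !psM1 psM0 Q0 R0 /E4 /E6 psD psB !psMnat one1.
rewrite -[coefs (Sig 3) 1]/(sig 3 1) -[coefs (Sig 5) 1]/(sig 5 1) !sig1.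
ring.
Qed.

(** * The product for Delta and its logarithmic derivative *)

Section Delta.

Notation X := (ps_X rat).

Definition Delta_prod N : pseries rat := X * \prod_(1 <= m < N.+1) (1 - X ^+ m) ^+ 24.

Lemma Delta_prodE n : Delta n = Delta_prod n n.
Proof.
rewrite /Delta -[LHS]/(ps_of_poly _ n); congr (coefs _ n).
rewrite rmorphM rmorph_prod /= ps_of_polyX; congr (_ * _).
by apply: eq_bigr => m _; rewrite rmorphXn rmorphB rmorph1 rmorphXn /= ps_of_polyX.
Qed.

Lemma Delta_prodS N : Delta_prod N.+1 = Delta_prod N * (1 - X ^+ N.+1) ^+ 24.
Proof. by rewrite /Delta_prod (big_nat_recr _ _ _ (ltn0Sn N)) [LHS]mulrA. Qed.

Lemma eqmodX_exp1 (N k : nat) (f : pseries rat) : eqmodX N f 1 -> eqmodX N (f ^+ k) 1.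
Proof. by move=> e; elim: k => [//|k IH]; rewrite exprS -[1]mulr1; apply: eqmodXM. Qed.

Lemma Delta_prod_stable N n : (n <= N)%N -> Delta_prod N n = Delta n.
Proof.
elim: N => [|N IH]; first by rewrite leqn0 => /eqP ->; rewrite Delta_prodE.
rewrite leq_eqVlt => /orP[/eqP ->|nN]; first by rewrite Delta_prodE.
rewrite -IH // Delta_prodS -[in RHS](mulr1 (Delta_prod N)).
apply: (@eqmodXM _ N.+1) => //; apply: eqmodX_exp1 => i iN.
by rewrite psB psXn (ltn_eqF iN) mulr0n subr0.
Qed.

Definition geom m : pseries rat := PSeries (fun n => ((0 < n) && (m %| n))%N%:R).

Lemma geomE m : (0 < m)%N -> (1 - X ^+ m) * geom m = X ^+ m.
Proof.
move=> m0; rewrite mulrBl mul1r; apply: pseriesP => n; rewrite psB psXnM psXn /=.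
case: (leqP m n) => mn; last first.
  by rewrite subr0 (ltn_eqF mn); case: posnP => //= n0; rewrite gtnNdvd.
have -> : (m %| n - m)%N = (m %| n)%N by rewrite -[in RHS](subnK mn) dvdn_addl.
rewrite subn_gt0 (leq_trans m0 mn) /=.
case: (eqVneq n m) => [->|nm]; first by rewrite dvdnn ltnn subr0.
by rewrite ltn_neqAle eq_sym nm mn /= subrr.
Qed.

Lemma qD_Delta_prod N : qD (Delta_prod N) =
  Delta_prod N * (1 - 24 * \sum_(1 <= m < N.+1) m%:R * geom m).
Proof.
elim: N => [|N IH].
  rewrite /Delta_prod !big_geq // mulr0 subr0 !mulr1 -[X]expr1 qD_X expr1; ring.
have Du : qD (1 - X ^+ N.+1) = - (N.+1%:R * ((1 - X ^+ N.+1) * geom N.+1)).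
  by rewrite geomE // qDD qDN qD1 qD_X add0r.
have -> : \sum_(1 <= m < N.+2) m%:R * geom m =
    \sum_(1 <= m < N.+1) m%:R * geom m + N.+1%:R * geom N.+1.
  exact: (big_nat_recr _ _ _ (ltn0Sn N)).
rewrite Delta_prodS qDM IH qDX Du [24.-1]/=.
set u := 1 - X ^+ _; ring.
Qed.

Definition DeltaS : pseries rat := PSeries Delta.

Lemma qD_Delta : qD DeltaS = E2 * DeltaS.
Proof.
apply: pseriesP => n.
have e : eqmodX n.+1 (Delta_prod n) DeltaS by move=> i; rewrite ltnS; apply: Delta_prod_stable.
rewrite mulrC; transitivity (qD (Delta_prod n) n); first by rewrite /= Delta_prodE.
rewrite qD_Delta_prod; apply: (eqmodXM e _ (ltnSn n)) => i; rewrite ltnS => i_n.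
rewrite /E2 !psB !psMnat; congr (_ - _ * _); rewrite ps_sum -[RHS]/(sig 1 i) /sig.
transitivity (\sum_(1 <= m < n.+1) m%:R * ((0 < i) && (m %| i))%N%:R : rat).
  by apply: eq_bigr => m _; rewrite psMnat.
rewrite (@big_cat_nat _ _ _ i.+1) //= [X in _ + X]big_nat_cond [X in _ + X]big1 ?addr0.
  rewrite [RHS]big_mkcond; apply: eq_big_nat => m /andP[m0 mi].
  case: ifP => [mdi|_]; last by rewrite andbF mulr0.
  by rewrite (leq_trans m0) ?mulr1 // -ltnS.
move=> m /andP[/andP[im _] _].
by have [->|i0] := posnP i; rewrite /= ?(gtnNdvd i0 im) ?andbF mulr0.
Qed.

Lemma Delta1 : Delta 1 = 1.
Proof.
rewrite Delta_prodE /Delta_prod big_nat1 psXM.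
by rewrite -[LHS]/(((1 - X ^+ 1) ^+ 24) 0%N) psX0 psB psXn mulr0n subr0 expr1n.
Qed.
End Delta.

Lemma fmulE (f g : pseries rat) : fmul f g = coefs (f * g). Proof. by []. Qed.
Lemma fpowE (f : pseries rat) k : fpow f k = coefs (f ^+ k).
Proof.
elim: k => [|k IH]; last by rewrite exprS -fmulE /= IH.
by apply: funext => n; rewrite /fone expr0 ps1.
Qed.

Lemma eta_quotient_logderiv p (d : pseries rat) : (1 < p)%N -> d 0%N = 0 -> d 1%N = 1 ->
  d ^+ p.-1 * DeltaS = qpow p DeltaS -> (p%:R - 1) * qD d = d * (p%:R * qpow p E2 - E2).
Proof.
move=> p1 d0 d1 e; have := congr1 (@qD _) e.
rewrite qDM qDX qD_qpow ?(ltnW p1) // qD_Delta rmorphM /= -e.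
have dn : d != 0 by apply: (@ps_neq0 _ _ 1); rewrite d1 oner_neq0.
have Dn : DeltaS != 0 by apply: (@ps_neq0 _ _ 1); rewrite /= Delta1 oner_neq0.
case: p p1 e => [|[|k]] // _ _ /= D.
apply: (mulfI (mulf_neq0 (expf_neq0 k dn) Dn)); apply: (lincomb1 (c := 1) D).
by rewrite -natr1 exprS; ring.
Qed.

Lemma eta_quotient_unique p (d t : pseries rat) : (1 < p)%N ->
  d 0%N = 0 -> d 1%N = 1 -> t 0%N = 0 -> t 1%N = 1 ->
  (p%:R - 1) * qD d = d * (p%:R * qpow p E2 - E2) ->
  (p%:R - 1) * qD t = t * (p%:R * qpow p E2 - E2) -> d = t.
Proof.
move=> p1 d0 d1 t0 t1 Dd Dt.
have p1' : p%:R - 1 != 0 :> rat by rewrite subr_eq0 pnatr_eq1 gtn_eqF.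
pose k : pseries rat := ps_const (p%:R - 1)^-1.
have kE : k * (p%:R - 1) = 1.
  by rewrite -(rmorph_nat (@ps_const rat)) -(rmorph1 (@ps_const rat)) -rmorphB -rmorphM mulVf.
have H f : (p%:R - 1) * qD f = f * (p%:R * qpow p E2 - E2) ->
    qD f = f * (k * (p%:R * qpow p E2 - E2)).
  by move=> e; rewrite mulrCA -e mulrA kE mul1r.
apply: (qD_logderiv_inj _ (H _ Dd) (H _ Dt)); last by rewrite d1.
have [[P0 _ _] _] := eisenstein_ramanujan.
by rewrite psCM psB psMnat qpow0 ?(ltnW p1) // P0 mulr1 mulVf.
Qed.

(** * The genus zero levels *)

(* [Nr] is the reversed polynomial y^(p+1) B(1/y) A2(1/y)^3. *)
Record reversal_data (p k : nat) (B A A2 Nr : {poly int}) : Prop := ReversalData {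
  rd_size : size Nr = p.+2;
  rd_monic : Nr \is monic;
  rd_rev : forall (L : fieldType) (u : L), u != 0 ->
    ev Nr u^-1 * u ^+ p.+1 = ev B u * ev A2 u ^+ 3;
  rd_fricke : forall (R : comNzRingType) (v : R),
    ev Nr (k%:R * v) = k%:R * (ev B v * ev A v ^+ 3)
}.

Lemma deriv_natr n : (n%:R : {poly int})^`() = 0.
Proof. by rewrite -polyC_natr derivC. Qed.
Lemma deriv_natrM n (P : {poly int}) : (n%:R * P)^`() = n%:R * P^`().
Proof. by rewrite derivM deriv_natr mul0r add0r. Qed.
Lemma deriv_natrXM n k (P : {poly int}) : (n%:R ^+ k * P)^`() = n%:R ^+ k * P^`().
Proof. by rewrite -natrX deriv_natrM. Qed.
Lemma deriv_Xn k : ('X ^+ k : {poly int})^`() = k%:R * 'X ^+ k.-1.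
Proof. by rewrite derivXn mulr_natl. Qed.
Definition derivs :=
  (derivD, derivN, deriv_natrM, deriv_natrXM, deriv_Xn, derivX, deriv_natr, deriv_natr 1).

Lemma coef0_eq1 (P : {poly int}) :
  (forall R : comNzRingType, ev P (0 : R) = 1) -> P`_0 = 1.
Proof.
move/(_ int) <-; elim/poly_ind: P => [|P c _]; first by rewrite coef0 ev0.
by rewrite !evE mulr0 add0r coefD coefMX coefC add0r intz.
Qed.

Lemma size_monic_Xn_add n (P : {poly int}) : (size P <= n)%N ->
  size ('X ^+ n + P) = n.+1 /\ 'X ^+ n + P \is monic.
Proof.
move=> sP; rewrite size_polyDl ?size_polyXn // ?ltnS //; split=> //.
by rewrite monicE lead_coefDl ?size_polyXn ?ltnS // lead_coefXn.
Qed.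

Ltac solve_level_data :=
  split; [split; split; apply: coef0_eq1 => R; rewrite !evE; ring
    | ring | ring | rewrite ?derivs /=; ring ..].

Lemma size_le_add n (P Q : {poly int}) :
  (size P <= n)%N -> (size Q <= n)%N -> (size (P + Q)%R <= n)%N.
Proof. by move=> sP sQ; rewrite (leq_trans (size_polyD _ _)) // geq_max sP. Qed.

Lemma size_le_natr n c : (size (c%:R : {poly int})%R <= n.+1)%N.
Proof. by rewrite -polyC_natr (leq_trans (size_polyC_leq1 _)). Qed.

Lemma size_le_natrX n c k : (k < n)%N -> (size (c%:R * 'X ^+ k : {poly int})%R <= n)%N.
Proof.
move=> kn; rewrite -polyC_natr mul_polyC (leq_trans (size_scale_leq _ _)) //.
by rewrite size_polyXn.
Qed.

Lemma monic_mul_cube b a (P Q : {poly int}) : size P = b.+1 /\ P \is monic ->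
  size Q = a.+1 /\ Q \is monic -> size (P * Q ^+ 3) = (b + a * 3).+1 /\ P * Q ^+ 3 \is monic.
Proof.
move=> [sP mP] [sQ mQ]; have mQ3 : Q ^+ 3 \is monic by apply: monic_exp.
rewrite rpredM // size_Mmonic ?monic_neq0 // sP -(prednK (_ : 0 < size (Q ^+ 3)%R)%N).
  by rewrite size_exp sQ; split=> //; rewrite addSn addnS.
by rewrite lt0n size_poly_eq0 monic_neq0.
Qed.

(** At every level, the degrees of B and C are the numbers of elliptic points of order 3 and 2 on
    X_0(p), and the constant k of the Fricke involution is p^(12/(p-1)), here 2^12. *)
Lemma level2 : level_data 2 1728
  (1) (1 + 64 * 'X)
  (1 + 256 * 'X)
  (1 - 512 * 'X)
  (1 + 16 * 'X)
  (1 - 8 * 'X).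
Proof. by solve_level_data. Qed.

(** The trivial factor and the exponent 1 in the reversed polynomial give it the shape required by
    [monic_mul_cube]. *)
Lemma reversal2 : reversal_data 2 4096 (1)
  (1 + 256 * 'X)
  (1 + 16 * 'X)
  (1 * ('X ^+ 1 + 16) ^+ 3).
Proof.
have [sN mN] := monic_mul_cube (conj (size_poly1 _) (monic1 _))
  (size_monic_Xn_add (@size_le_natr 0 16)).
split=> //.
- by move=> L u u0; rewrite !evE; field.
- by move=> R v; rewrite !evE; ring.
Qed.

Lemma level3 : level_data 3 1728
  (1 + 27 * 'X) (1)
  (1 + 243 * 'X)
  (1 - 486 * 'X - 3 ^+ 9 * 'X ^+ 2)
  (1 + 3 * 'X)
  (1 + 18 * 'X - 27 * 'X ^+ 2).
Proof. by solve_level_data. Qed.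

Lemma reversal3 : reversal_data 3 729 (1 + 27 * 'X)
  (1 + 243 * 'X)
  (1 + 3 * 'X)
  (('X ^+ 1 + 27) * ('X ^+ 1 + 3) ^+ 3).
Proof.
have [sN mN] := monic_mul_cube
  (size_monic_Xn_add (@size_le_natr 0 27))
  (size_monic_Xn_add (@size_le_natr 0 3)).
split=> //.
- by move=> L u u0; rewrite !evE; field.
- by move=> R v; rewrite !evE; ring.
Qed.

Lemma level5 : level_data 5 1728
  (1) (1 + 22 * 'X + 125 * 'X ^+ 2)
  (1 + 250 * 'X + 5 ^+ 5 * 'X ^+ 2)
  (1 - 500 * 'X - 5 ^+ 6 * 'X ^+ 2)
  (1 + 10 * 'X + 5 * 'X ^+ 2)
  (1 + 4 * 'X - 'X ^+ 2).
Proof. by solve_level_data. Qed.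

Lemma reversal5 : reversal_data 5 125 (1)
  (1 + 250 * 'X + 5 ^+ 5 * 'X ^+ 2)
  (1 + 10 * 'X + 5 * 'X ^+ 2)
  (1 * ('X ^+ 2 + (10 * 'X ^+ 1 + 5)) ^+ 3).
Proof.
have [sN mN] := monic_mul_cube (conj (size_poly1 _) (monic1 _))
  (size_monic_Xn_add (size_le_add (@size_le_natrX 2 10 1 isT) (@size_le_natr 1 5))).
split=> //.
- by move=> L u u0; rewrite !evE; field.
- by move=> R v; rewrite !evE; ring.
Qed.

Lemma level7 : level_data 7 1728
  (1 + 13 * 'X + 49 * 'X ^+ 2) (1)
  (1 + 245 * 'X + 7 ^+ 4 * 'X ^+ 2)
  (1 - 490 * 'X - 9 * (7 ^+ 4 * 'X ^+ 2) - 2 * (7 ^+ 6 * 'X ^+ 3) - 7 ^+ 7 * 'X ^+ 4)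
  (1 + 5 * 'X + 'X ^+ 2)
  (1 + 14 * 'X + 63 * 'X ^+ 2 + 70 * 'X ^+ 3 - 7 * 'X ^+ 4).
Proof. by solve_level_data. Qed.

Lemma reversal7 : reversal_data 7 49 (1 + 13 * 'X + 49 * 'X ^+ 2)
  (1 + 245 * 'X + 7 ^+ 4 * 'X ^+ 2)
  (1 + 5 * 'X + 'X ^+ 2)
  (('X ^+ 2 + (13 * 'X ^+ 1 + 49)) * ('X ^+ 2 + (5 * 'X ^+ 1 + 1%:R)) ^+ 3).
Proof.
have [sN mN] := monic_mul_cube
  (size_monic_Xn_add (size_le_add (@size_le_natrX 2 13 1 isT) (@size_le_natr 1 49)))
  (size_monic_Xn_add (size_le_add (@size_le_natrX 2 5 1 isT) (@size_le_natr 1 1))).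
split=> //.
- by move=> L u u0; rewrite !evE; field.
- by move=> R v; rewrite !evE; ring.
Qed.

Lemma level13 : level_data 13 1728
  (1 + 5 * 'X + 13 * 'X ^+ 2) (1 + 6 * 'X + 13 * 'X ^+ 2)
  (1 + 247 * 'X + 20 * (13 ^+ 2 * 'X ^+ 2) + 7 * (13 ^+ 3 * 'X ^+ 3) + 13 ^+ 4 * 'X ^+ 4)
  (1 - 494 * 'X - 122 * (13 ^+ 2 * 'X ^+ 2) - 108 * (13 ^+ 3 * 'X ^+ 3)
     - 46 * (13 ^+ 4 * 'X ^+ 4) - 10 * (13 ^+ 5 * 'X ^+ 5) - 13 ^+ 6 * 'X ^+ 6)
  (1 + 7 * 'X + 20 * 'X ^+ 2 + 19 * 'X ^+ 3 + 'X ^+ 4)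
  (1 + 10 * 'X + 46 * 'X ^+ 2 + 108 * 'X ^+ 3 + 122 * 'X ^+ 4 + 38 * 'X ^+ 5 - 'X ^+ 6).
Proof. by solve_level_data. Qed.

Lemma reversal13 : reversal_data 13 13 (1 + 5 * 'X + 13 * 'X ^+ 2)
  (1 + 247 * 'X + 20 * (13 ^+ 2 * 'X ^+ 2) + 7 * (13 ^+ 3 * 'X ^+ 3) + 13 ^+ 4 * 'X ^+ 4)
  (1 + 7 * 'X + 20 * 'X ^+ 2 + 19 * 'X ^+ 3 + 'X ^+ 4)
  (('X ^+ 2 + (5 * 'X ^+ 1 + 13)) *
   ('X ^+ 4 + (7 * 'X ^+ 3 + 20 * 'X ^+ 2 + 19 * 'X ^+ 1 + 1%:R)) ^+ 3).
Proof.
have [sN mN] := monic_mul_cube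
  (size_monic_Xn_add (size_le_add (@size_le_natrX 2 5 1 isT) (@size_le_natr 1 13)))
  (size_monic_Xn_add (size_le_add (size_le_add (size_le_add (@size_le_natrX 4 7 3 isT)
    (@size_le_natrX 4 20 2 isT)) (@size_le_natrX 4 19 1 isT)) (@size_le_natr 3 1))).
split=> //.
- by move=> L u u0; rewrite !evE; field.
- by move=> R v; rewrite !evE; ring.
Qed.

(** * Conjugates and the logarithmic derivative *)

Lemma ps_comp_const (R S : comNzRingType) (phi : {rmorphism R -> S}) c (f : pseries R) n :
  ps_comp phi (ps_const c) f n = phi (f n) * c ^+ n.
Proof.
have e i : ((ps_X S * ps_const c) ^+ i) n = (n == i)%:R * c ^+ i.
  by rewrite exprMn -rmorphXn mulrC psCM psXn mulrC.
rewrite /=; under eq_bigr => i _ do rewrite e.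
rewrite big_ord_recr /= eqxx mul1r big1 ?add0r // => i _.
by rewrite gtn_eqF ?mul0r ?mulr0 //= ltn_ord.
Qed.

Lemma ps_comp1 (R S : comNzRingType) (phi : {rmorphism R -> S}) (f : pseries R) n :
  ps_comp phi 1 f n = phi (f n).
Proof. by rewrite -(rmorph1 (@ps_const S)) ps_comp_const expr1n mulr1. Qed.

Lemma ps_comp1_const (R S : comNzRingType) (phi : {rmorphism R -> S}) c :
  ps_comp phi 1 (ps_const c) = ps_const (phi c).
Proof. by apply: pseriesP => n; rewrite ps_comp1 /=; case: eqP; rewrite ?rmorph0. Qed.

Lemma qD_ps_comp1 (R S : comNzRingType) (phi : {rmorphism R -> S}) (f : pseries R) :
  ps_comp phi 1 (qD f) = qD (ps_comp phi 1 f).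
Proof.
apply: pseriesP => n; rewrite ps_comp1 -[RHS]/(n%:R * _ n) ps_comp1 /=.
by rewrite rmorphM rmorph_nat.
Qed.

Section LogDerivative.
Variable R : comNzRingType.
Notation Y := (ps_X R).

Definition pow_series (u : R) : pseries R := PSeries (fun j => if j == 0%N then 0 else u ^+ j).

Lemma pow_seriesE u : (1 - ps_const u * Y) * pow_series u = ps_const u * Y.
Proof.
rewrite mulrBl mul1r; apply: pseriesP => n; rewrite psB -mulrA !psCM psXM /=.
case: n => [|[|n]] /=; first by rewrite !mulr0 subr0.
  by rewrite mulr0 subr0 mulr1.
by rewrite -exprS subrr mulr0.
Qed.

Lemma qD_prod (I : Type) (s : seq I) (u : I -> R) :
  qD (\prod_(i <- s) (1 - ps_const (u i) * Y)) =
  - (\prod_(i <- s) (1 - ps_const (u i) * Y)) * \sum_(i <- s) pow_series (u i).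
Proof.
elim: s => [|i s IH]; first by rewrite !big_nil qD1 mulr0.
rewrite !big_cons qDM IH qDD qDN qD1 qDM qD_const -[Y]expr1 qD_X !expr1.
by apply: (lincomb1 (c := \prod_(i <- s) (1 - ps_const (u i) * Y)) (pow_seriesE (u i))); ring.
Qed.
End LogDerivative.

Lemma prim_root_sum (K : fieldType) p (z : K) n : p.-primitive_root z ->
  \sum_(k < p) (z ^+ k) ^+ n = ((p %| n)%N * p)%:R.
Proof.
move=> pz; under eq_bigr => k _ do rewrite exprAC.
have [pn|pn] := boolP (p %| n)%N.
  have -> : z ^+ n = 1 by apply/eqP; rewrite -(prim_order_dvd pz).
  under eq_bigr => k _ do rewrite expr1n.
  by rewrite sumr_const card_ord mul1n.
have zn : z ^+ n - 1 != 0 by rewrite subr_eq0 -(prim_order_dvd pz).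
by apply: (mulfI zn); rewrite -subrX1 exprAC (prim_expr_order pz) expr1n subrr mul0n mulr0.
Qed.

Lemma ev_polyX (R : comNzRingType) P : ev P ('X : {poly R}) = map_poly intr P.
Proof.
elim/poly_ind: P => [|P c IH]; first by rewrite ev0 rmorph0.
by rewrite !evE IH rmorphD rmorphM /= map_polyX map_polyC /= rmorph_int.
Qed.

Lemma ev_at0 (R : comNzRingType) P : ev P (0 : R) = (P`_0)%:~R.
Proof.
elim/poly_ind: P => [|P c _]; first by rewrite ev0 coef0.
by rewrite !evE mulr0 add0r coefD coefMX coefC add0r.
Qed.

(* The roots in y are k v and the inverses of the u i, the former because of the Fricke
   involution t -> 1/(k t), which exchanges the expressions of j(q) and j(q^p). *)
Lemma reversal_factor (L : fieldType) p k (B A A2 Nr : {poly int}) (u : 'I_p -> L) (v : L) :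
  (0 < p)%N -> B`_0 = 1 -> A`_0 = 1 -> reversal_data p k B A A2 Nr ->
  k%:R != 0 :> L -> v != 0 -> (forall i, u i != 0) -> injective u ->
  (forall i, u i * (k%:R * v) != 1) ->
  (forall i, v * (ev B (u i) * ev A2 (u i) ^+ 3) = u i ^+ p * (ev B v * ev A v ^+ 3)) ->
  v%:P * map_poly intr Nr - (ev B v * ev A v ^+ 3)%:P * 'X =
  ((k%:R * v)%:P - 'X) * \prod_(i < p) (1 - (u i)%:P * 'X).
Proof.
move=> p0 B0 A0 RD k0 v0 u0 uI uv rel; set nv := ev B v * _.
pose nr : {poly L} := map_poly intr Nr; pose WL := v%:P * nr - nv%:P * 'X.
have lc0 : ((lead_coef Nr)%:~R : L) != 0 by rewrite (monicP (rd_monic RD)) oner_neq0.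
have snr : size nr = p.+2 by rewrite /nr size_map_poly_id0 // (rd_size RD).
have lnr : lead_coef nr = 1.
  by rewrite /nr lead_coef_map_id0 // (monicP (rd_monic RD)).
have sX : (size (- (nv%:P * 'X)) < size (v%:P * nr)%R)%N.
  rewrite size_polyN !mul_polyC [X in (_ < X)%N]size_scale // snr.
  by rewrite (leq_ltn_trans (size_scale_leq _ _)) // size_polyX !ltnS.
have sW : size WL = p.+2 by rewrite size_polyDl // mul_polyC size_scale.
have lW : lead_coef WL = v by rewrite lead_coefDl // mul_polyC lead_coefZ lnr mulr1.
have WLx x : WL.[x] = v * ev Nr x - nv * x by rewrite !hornerE.
pose rs := k%:R * v :: [seq (u i)^-1 | i <- enum 'I_p].
have rW : all (root WL) rs.
  rewrite /= rootE WLx (rd_fricke RD) -/nv; apply/andP; split; first by apply/eqP; ring.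
  apply/allP => x /mapP[i _ ->]; rewrite rootE WLx.
  apply/eqP/(mulIf (expf_neq0 p.+1 (u0 i))); rewrite mul0r mulrBl -mulrA (rd_rev RD) // rel.
  by rewrite -/nv exprS; field.
have urs : uniq_roots rs.
  rewrite uniq_rootsE /= map_inj_uniq ?enum_uniq ?andbT => [|i j /invr_inj/uI //].
  apply/negP => /mapP[i _ kv]; have := uv i.
  by rewrite kv divff ?eqxx.
have szrs : size WL = (size rs).+1 by rewrite sW /= size_map size_enum_ord.
have WE := all_roots_prod_XsubC szrs rW urs; rewrite lW big_cons big_map big_enum /= in WE.
rewrite -/nr -/WL.
pose c : L := \prod_(i < p) (- (u i)^-1).
have PE : \prod_(i < p) ('X - ((u i)^-1)%:P) = c%:P * \prod_(i < p) (1 - (u i)%:P * 'X).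
  rewrite /c rmorph_prod -big_split; apply: eq_bigr => i _ /=.
  rewrite mulrBr mulr1 polyCN mulNr mulrA -polyCM mulVf // polyC1; ring.
(* The roots determine the polynomial up to normalisation; comparing values at 0, where the Fricke
   relation gives Nr(0) = k, yields v c = -1. *)
have W0 : v * k%:R = - (v * (k%:R * v) * c).
  have : WL.[0] = v * k%:R.
    rewrite WLx mulr0 subr0; have := rd_fricke RD (0 : L).
    by rewrite mulr0 !ev_at0 B0 A0 => ->; rewrite expr1n !mulr1.
  rewrite WE hornerZ hornerM PE hornerM hornerC horner_prod big1 => [<-|i _].
    by rewrite !hornerE /=; ring.
  by rewrite !hornerE ?mulr0 ?subr0.
have vc : v * c = -1.
  by apply: (mulfI (mulf_neq0 v0 k0)); apply: (lincomb1 (c := 1) W0); ring.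
rewrite WE PE -mul_polyC.
have vcP : v%:P * c%:P = -1 :> {poly L} by rewrite -polyCM vc polyCN.
set P := \prod_(i < p) _.
by apply: (lincomb1 (c := ('X - (k%:R * v)%:P) * P) vcP); ring.
Qed.
(** The inverses of the u i do not exist among power series, so the factorisation is proved over the
    fraction field and pulled back; its two sides contain no inverse. *)
Lemma reversal_factor_idomain (D : idomainType) p k (B A A2 Nr : {poly int})
    (u : 'I_p -> D) (v : D) :
  (0 < p)%N -> B`_0 = 1 -> A`_0 = 1 -> reversal_data p k B A A2 Nr ->
  k%:R != 0 :> D -> v != 0 -> (forall i, u i != 0) -> injective u ->
  (forall i, u i * (k%:R * v) != 1) ->
  (forall i, v * (ev B (u i) * ev A2 (u i) ^+ 3) = u i ^+ p * (ev B v * ev A v ^+ 3)) ->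
  v%:P * map_poly intr Nr - (ev B v * ev A v ^+ 3)%:P * 'X =
  ((k%:R * v)%:P - 'X) * \prod_(i < p) (1 - (u i)%:P * 'X).
Proof.
move=> p0 B0 A0 RD k0 v0 u0 uI uv rel.
have fI : injective (@tofrac D) by move=> x y /eqP; rewrite tofrac_eq => /eqP.
have fn x : x != 0 -> tofrac x != 0 by rewrite tofrac_eq0.
pose f : {rmorphism D -> {fraction D}} := @tofrac D.
apply: (map_inj_poly fI (rmorph0 f)).
rewrite rmorphB !(rmorphM (map_poly f)) rmorphB rmorph_prod /= !map_polyC !map_polyX /=
  -map_poly_comp.
rewrite (eq_map_poly (g := intr)); last by move=> x /=; rewrite (rmorph_int f).
have nvE : tofrac (ev B v * ev A v ^+ 3) = ev B (f v) * ev A (f v) ^+ 3.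
  by rewrite (rmorphM f) (rmorphXn f) !(ev_rmorph f).
have kvE : tofrac (k%:R * v) = k%:R * f v by rewrite (rmorphM f) (rmorph_nat f).
rewrite nvE kvE.
rewrite (@reversal_factor _ p k B A A2 Nr (fun i => f (u i)) (f v)) //.
- congr (_ * _); apply: eq_bigr => i _.
  by rewrite rmorphB rmorphM rmorph1 /= map_polyC map_polyX.
- by rewrite -(rmorph_nat f); apply: fn.
- exact: fn.
- by move=> i; apply: fn.
- by move=> i j /fI/uI.
- move=> i; rewrite -(rmorph_nat f) -!rmorphM -(rmorph1 f).
  by apply: contraNneq (uv i) => /fI ->.
- by move=> i; rewrite -!(ev_rmorph f) -!rmorphXn -!rmorphM rel.
Qed.

Section Roots.
Variables (p k : nat) (B A A2 Nr : {poly int}) (d : pseries rat).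
Hypotheses (p_gt1 : (1 < p)%N) (k_gt0 : (0 < k)%N).
Hypotheses (d0 : d 0%N = 0) (d1 : d 1%N = 1).
Hypotheses (B0 : B`_0 = 1) (A0 : A`_0 = 1).
Hypothesis RD : reversal_data p k B A A2 Nr.
Hypothesis modular : qpow p d * (ev B d * ev A2 d ^+ 3) =
  d ^+ p * (ev B (qpow p d) * ev A (qpow p d) ^+ 3).

Local Notation K := algC.
Variable z : K.
Hypothesis z_prim : p.-primitive_root z.

Definition conj_root i : pseries K := ps_comp (@ratr K) (ps_const (z ^+ i)) d.
Definition dqp : pseries K := ps_comp (@ratr K) 1 (qpow p d).
Definition numer_dqp : pseries K := ev B dqp * ev A dqp ^+ 3.

Let p_gt0 : (0 < p)%N. Proof. exact: ltnW. Qed.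

Lemma conj_root_coef i j n : (conj_root i ^+ j) n = ratr ((d ^+ j) n) * (z ^+ i) ^+ n.
Proof. by rewrite -rmorphXn ps_comp_const. Qed.

(** The substitution q -> z^i q fixes d(q^p), so the modular equation passes to each conjugate. *)
Lemma conj_root_modular i :
  dqp * (ev B (conj_root i) * ev A2 (conj_root i) ^+ 3) = conj_root i ^+ p * numer_dqp.
Proof.
have dqpE : dqp = ps_comp (@ratr K) (ps_const (z ^+ i)) (qpow p d).
  apply: pseriesP => n; rewrite ps_comp1 ps_comp_const qpowE //.
  case: ifP => [/dvdnP[e ->]|]; last by rewrite rmorph0 mul0r.
  by rewrite exprAC mulnC exprM (prim_expr_order z_prim) !expr1n mulr1.
rewrite /numer_dqp dqpE /conj_root -!ev_rmorph -!rmorphXn -!rmorphM; congr (ps_comp _ _ _).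
by rewrite modular rmorphM rmorphXn !ev_rmorph.
Qed.

Lemma dqp_p : dqp p = 1. Proof. by rewrite ps_comp1 qpow_p // d1 rmorph1. Qed.
Lemma dqp_neq0 : dqp != 0. Proof. by apply: (@ps_neq0 _ _ p); rewrite dqp_p oner_neq0. Qed.

Lemma conj_root0 i : conj_root i 0%N = 0.
Proof. by rewrite ps_comp_const d0 rmorph0 mul0r. Qed.
Lemma conj_root1 i : conj_root i 1%N = z ^+ i.
Proof. by rewrite ps_comp_const d1 rmorph1 mul1r expr1. Qed.

Definition revpol : {poly pseries K} := dqp%:P * ev Nr 'X - numer_dqp%:P * 'X.

Lemma revpol_factor :
  revpol = ((k%:R * dqp)%:P - 'X) * \prod_(i < p) (1 - (conj_root i)%:P * 'X).
Proof.
rewrite /revpol ev_polyX; apply: (reversal_factor_idomain (u := fun i => conj_root i) p_gt0 B0 A0 RD).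
- apply: (@ps_neq0 _ _ 0); rewrite -(rmorph_nat (@ps_const K)) /=.
  by rewrite pnatr_eq0 -lt0n.
- exact: dqp_neq0.
- move=> i; apply: (@ps_neq0 _ _ 1); rewrite conj_root1 expf_neq0 //.
  apply/eqP => z0; have := prim_expr_order z_prim; rewrite z0 expr0n gtn_eqF // => /eqP.
  by rewrite eq_sym oner_eq0.
- move=> i j /(congr1 (fun f => coefs f 1)); rewrite !conj_root1 => /eqP.
  by rewrite (eq_prim_root_expr z_prim) !modn_small // => /eqP/val_inj.
- move=> i; apply/eqP => /(congr1 (fun f => coefs f 0)) /eqP.
  by rewrite psM0 conj_root0 mul0r ps1 eq_sym oner_eq0.
- by move=> i; apply: conj_root_modular.
Qed.
End Roots.

Section NestedSeries.
Variable R : comNzRingType.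

Definition revW (Nr : {poly int}) (v nv : R) : pseries R :=
  ps_const v * ev Nr (ps_X R) - ps_const nv * ps_X R.

Lemma revW_logderiv p (Nr : {poly int}) (v nv kv : R) (u : 'I_p -> R) :
  v%:P * ev Nr 'X - nv%:P * 'X = (kv%:P - 'X) * \prod_(i < p) (1 - (u i)%:P * 'X) ->
  (ps_const kv - ps_X R) * qD (revW Nr v nv) =
  - (ps_X R * revW Nr v nv) -
    (ps_const kv - ps_X R) * revW Nr v nv * \sum_(i < p) pow_series (u i).
Proof.
move/(congr1 (@ps_of_poly R)).
rewrite rmorphB !(rmorphM (@ps_of_poly R)) rmorphB rmorph_prod /=
  (ev_rmorph (@ps_of_poly R)) /= !ps_of_polyC !ps_of_polyX -/(revW _ _ _) => ->.
under eq_bigr => i _ do rewrite rmorphB rmorphM rmorph1 /= ps_of_polyC ps_of_polyX.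
rewrite qDM qD_prod qDD qDN qD_const -[ps_X R]expr1 qD_X expr1; ring.
Qed.
End NestedSeries.

(** * Descent from the conjugates to Q[[x]][[y]] *)

Section Descent.
Variables (p k : nat) (B A A2 Nr : {poly int}) (d : pseries rat) (M : nat -> nat -> rat).
Hypotheses (p_gt1 : (1 < p)%N) (k_gt0 : (0 < k)%N).
Hypotheses (d0 : d 0%N = 0) (d1 : d 1%N = 1).
Hypotheses (B0 : B`_0 = 1) (A0 : A`_0 = 1).
Hypothesis RD : reversal_data p k B A A2 Nr.
Hypothesis modular : qpow p d * (ev B d * ev A2 d ^+ 3) =
  d ^+ p * (ev B (qpow p d) * ev A (qpow p d) ^+ 3).
Hypothesis UM : forall j n, (0 < j)%N ->
  (d ^+ j) (p * n)%N = \sum_(1 <= i < n.+1) M i j * (d ^+ i) n.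

Local Notation x := (ps_X rat).
Local Notation Y := (ps_X (pseries rat)).

(* The outer variable is y, the inner one x. *)
Definition Mser : pseries (pseries rat) :=
  PSeries (fun j => PSeries (fun i => if (0 < i)%N && (0 < j)%N then M i j else 0)).
Definition kx : pseries (pseries rat) := ps_const (k%:R * x).
Definition revser : pseries (pseries rat) := revW Nr x (ev B x * ev A x ^+ 3).

Lemma Mser_comp hd j : d = x * hd -> (0 < j)%N ->
  forall n, ps_comp idfun hd (Mser j) n = (d ^+ j) (p * n)%N.
Proof.
move=> dE j0 n; rewrite UM // /= -dE j0.
rewrite big_ord_recl /= mul0r add0r big_add1 /= big_mkord.
by apply: eq_bigr.
Qed.

(** After x is replaced by d(q^p) this is [revW_logderiv]. Nothing is divided out, so that both
    sides make sense in Q[[x]][[y]] and injectivity of the substitution suffices. *)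
Lemma revser_logderiv :
  (kx - Y) * qD revser = - (Y * revser) - (kx - Y) * revser * (p%:R * Mser).
Proof.
have p_gt0 : (0 < p)%N by apply: ltnW.
have [z pz] := C_prim_root_exists p_gt0.
have [hd dE] := ps_factorX d0.
have hd0 : hd != 0 by apply: (@ps_neq0 _ _ 0); rewrite -[hd _](psXM _ 1) -dE d1 oner_neq0.
(* [phi] sends x first to d(q), then to d(q^p), and embeds the coefficients in the algebraic
   numbers; [Phi] applies it to each coefficient in y. *)
pose phi : {rmorphism pseries rat -> pseries algC} :=
  ps_comp (@ratr algC) 1 \o (qpow p \o ps_comp idfun hd).
have phiI : injective phi.
  apply: inj_comp; first by apply: ps_comp_inj; exact: oner_neq0.
  apply: inj_comp; last exact: ps_comp_inj.
  apply: ps_comp_inj; apply: expf_neq0.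
  by apply: (@ps_neq0 _ _ 1); exact: oner_neq0.
have phix : phi x = dqp p d by rewrite /phi /= ps_compX -dE.
pose Phi : {rmorphism pseries (pseries rat) -> pseries (pseries algC)} := ps_comp phi 1.
have PhiI : injective Phi.
  move=> f g e; apply: pseriesP => n; apply: phiI.
  by rewrite -!(ps_comp1 phi) [ps_comp phi 1 f]e.
have PhiY : Phi Y = ps_X _ by rewrite /Phi /= ps_compX mulr1.
have PhiC f : Phi (ps_const f) = ps_const (phi f) by apply: ps_comp1_const.
have Phic : Phi kx = ps_const (k%:R * dqp p d) by rewrite PhiC rmorphM rmorph_nat phix.
have Phiw : Phi revser = revW Nr (dqp p d) (numer_dqp p B A d).
  rewrite /revser /revW rmorphB !(rmorphM Phi) ev_rmorph PhiY !PhiC phix.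
  by rewrite rmorphM rmorphXn !ev_rmorph phix.
have PhiM : Phi (p%:R * Mser) = \sum_(i < p) pow_series (conj_root d z i).
  apply: pseriesP => -[|j]; rewrite (ps_comp1 phi) psMnat ps_sum.
    rewrite (_ : Mser 0%N = 0); last by apply: pseriesP => i; rewrite /= andbF.
    by rewrite mulr0 rmorph0 big1.
  apply: pseriesP => n; rewrite ps_sum rmorphM rmorph_nat psMnat.
  transitivity (\sum_(i < p) ratr ((d ^+ j.+1) n) * (z ^+ i) ^+ n : algC); last first.
    by apply: eq_bigr => i _; rewrite -conj_root_coef.
  rewrite -mulr_sumr (prim_root_sum _ pz).
  rewrite [coefs (phi _) n](ps_comp1 (@ratr algC)) qpowE //.
  case: ifP => [pn|_]; last by rewrite mul0n rmorph0 !mulr0.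
  by rewrite (Mser_comp dE) // mulnC divnK // mul1n mulrC.
have PhiD : Phi (qD revser) = qD (Phi revser) by apply: qD_ps_comp1.
have PhicY : Phi (kx - Y) = Phi kx - Phi Y by rewrite rmorphB.
apply: PhiI; rewrite [RHS](rmorphB Phi) (rmorphN Phi) (rmorphM Phi (kx - Y)) (rmorphM Phi Y).
rewrite (rmorphM Phi ((kx - Y) * revser)) (rmorphM Phi (kx - Y)) PhiD PhicY PhiY Phic PhiM Phiw.
exact: (revW_logderiv (revpol_factor p_gt1 k_gt0 d0 d1 B0 A0 RD modular pz)).
Qed.

(** The differential equation defines I, with no division by [revser]. The product of [revser] and I
    then satisfies the same first-order equation as k x - y, with the same constant term in y. *)
Lemma revser_solution : exists I : pseries (pseries rat),
  [/\ I 0%N = 1, qD I = p%:R * Mser * I & revser * I = kx - Y].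
Proof.
pose F (I : pseries (pseries rat)) : pseries (pseries rat) :=
  PSeries (fun j => if j == 0%N then 1 else ps_const (j%:R^-1) * (p%:R * Mser * I) j).
have M0 : (p%:R * Mser) 0%N = 0.
  by rewrite psMnat (_ : Mser 0%N = 0) ?mulr0 //; apply: pseriesP => i; rewrite /= andbF.
have cF : contracting F.
  move=> N f g e j jN; rewrite /F /=; case: eqP => // _; congr (_ * _).
  exact: (eqmodXMS M0 e).
pose I := ps_fix F; have IE : I = F I by rewrite /I ps_fixE.
have DI : qD I = p%:R * Mser * I.
  apply: pseriesP => -[|j]; first by rewrite psM0 M0 mul0r /= mul0r.
  rewrite -[LHS]/(j.+1%:R * I j.+1) {1}IE /F [coefs (PSeries _) _]/= mulrA.
  rewrite -(rmorph_nat (@ps_const rat)) -rmorphM divff ?pnatr_eq0 // rmorph1 mul1r //.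
have I0 : I 0%N = 1 by rewrite IE.
exists I; split=> //.
have := revser_logderiv; set D := revser * I.
have D0 : D 0%N = k%:R * x.
  rewrite /D psM0 I0 mulr1 /revser /revW psB psCM psM0 ev_coef0 // [coefs Y _]/= mulr0 subr0.
  rewrite mulrC; congr (_ * _); have := rd_fricke RD (0 : pseries rat).
  by rewrite mulr0 !ev_at0 B0 A0 expr1n !mulr1.
move=> lw.
pose H := D - (kx - Y).
have H0 : H 0%N = 0 by rewrite /H !psB D0 [coefs Y _]/= subr0 subrr.
have DH : (kx - Y) * qD H = - (Y * H).
  rewrite /H qDD qDN qDD qDN qD_const -[in qD Y](expr1 Y) qD_X expr1 /D qDM DI.
  apply: (lincomb1 (c := I) lw); ring.
have kx : k%:R * x != 0 :> pseries rat.
  apply: mulf_neq0; last by apply: (@ps_neq0 _ _ 1); exact: oner_neq0.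
  by case: (k) k_gt0 => // n _; apply: ps_nat_neq0.
suff H_0 : H = 0 by apply/eqP; rewrite -subr_eq0 -/H H_0.
apply: pseriesP; elim=> [//|j IH].
(* The coefficient of y^(j+1) says k x (j + 1) H_(j+1) - j H_j = - H_j, and k x is not a zero
   divisor. *)
have := congr1 (fun f => coefs f j.+1) DH; rewrite mulrBl psB psN psCM !psXM.
rewrite -[qD H j.+1]/(j.+1%:R * H j.+1) -[qD H j]/(j%:R * H j) IH mulr0 subr0 oppr0.
by move=> e; apply: (mulfI (mulf_neq0 kx (ps_nat_neq0 j))); rewrite mulr0 -mulrA.
Qed.
End Descent.

(** * Two-variable series as nested series *)

Definition nested (f : fps2) : pseries (pseries rat) :=
  PSeries (fun j => PSeries (fun i => f i j)).

(** The indices are exchanged because y is the outer variable. *)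
Lemma fmul2E (a b : fps2) i j : fmul2 a b i j = (nested a * nested b) j i.
Proof. by rewrite psM ps_sum /fmul2 exchange_big. Qed.

Lemma nested_fmul2 (a b : fps2) : nested (fmul2 a b) = nested a * nested b.
Proof. by apply: pseriesP => j; apply: pseriesP => i; rewrite /= fmul2E. Qed.

Lemma nested_fone2 : nested fone2 = 1.
Proof.
apply: pseriesP => j; apply: pseriesP => i; rewrite ps1 /= /fone2.
by case: (j == 0%N); rewrite ?andbT ?andbF // ps1.
Qed.

Lemma nested_poly2 P : nested (poly2 P) = ps_of_poly (map_poly (@ps_of_poly rat) P).
Proof. by apply: pseriesP => j; apply: pseriesP => i; rewrite /= coef_map. Qed.

Lemma algebraic_of_level p k (B C A S A2 S2 Nr : {poly int}) (d : fps) (M : nat -> nat -> rat) :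
  (1 < p)%N -> (0 < k)%N -> level_data p 1728 B C A S A2 S2 -> reversal_data p k B A A2 Nr ->
  d 0%N = 0 -> d 1%N = 1 ->
  (forall n, fmul (fpow d p.-1) Delta n = Delta_at_pow p n) ->
  (forall j n, (0 < j)%N ->
     U_op p (fpow d j) n = \sum_(1 <= i < n.+1) M i j * fpow d i n) ->
  exists I : fps2,
    algebraic2 I /\ I 0%N 0%N != 0 /\
    forall i j,
      fmul2 (fun a b => if (0 < a)%N && (0 < b)%N then M a b else 0) I i j
      = (p%:R)^-1 * y_dy I i j.
Proof.
move=> p_gt1 k_gt0 LD RD d0 d1 dDelta UM.
pose dS : pseries rat := PSeries d.
have p_gt0 : (0 < p)%N by apply: ltnW.
have [[B0 _ A0] _] := ld_const LD.
have [t [t0 t1 Dt modular]] :=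
  hauptmodul_modular p_gt1 (isT : (0 < 1728)%N) LD eisenstein_ramanujan eisenstein_disc.
have dt : dS = t.
  apply: (eta_quotient_unique (d := dS) p_gt1 d0 d1 t0 t1 _ Dt).
  apply: eta_quotient_logderiv => //; apply: pseriesP => n.
  rewrite qpowE // -[RHS]/(Delta_at_pow p n) -dDelta.
  by rewrite -[LHS]/(fmul (coefs (dS ^+ p.-1)) Delta n) -fpowE.
have UM' j n : (0 < j)%N -> (dS ^+ j) (p * n)%N = \sum_(1 <= i < n.+1) M i j * (dS ^+ i) n.
  move=> j0; rewrite -fpowE -[LHS]/(U_op p (fpow d j) n) UM //.
  by apply: eq_bigr => i _; rewrite -fpowE.
rewrite -dt in modular.
have [I [I0 DI wI]] := revser_solution (d := dS) p_gt1 k_gt0 d0 d1 B0 A0 RD modular UM'.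
exists (fun i j => I j i); split; last split.
- pose N : {poly rat} := ev B 'X * ev A 'X ^+ 3.
  pose WP : {poly {poly rat}} := 'X%:P * ev Nr 'X - N%:P * 'X.
  pose cP : {poly {poly rat}} := 'X - (k%:R * 'X)%:P.
  (* The relation (y - k x) + W I = 0 has degree 1 in I; it is nontrivial because the first
     coefficient contains y. *)
  exists [:: cP; WP]; split.
    apply/orP; left; apply/eqP => /(congr1 (fun f : {poly _} => f`_1)) /eqP.
    by rewrite coefB coefX coefC subr0 coef0 oner_eq0.
  have nI : nested (fun i j => I j i) = I.
    by apply: pseriesP => j; apply: pseriesP.
  have ncP : nested (poly2 cP) = - (kx k - ps_X _).
    rewrite nested_poly2 /cP /kx !rmorphB /= map_polyX map_polyC /= ps_of_polyX ps_of_polyC.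
    by rewrite rmorphM rmorph_nat /= ps_of_polyX opprB.
  have nWP : nested (poly2 WP) = revser B A Nr.
    pose f : {rmorphism {poly {poly rat}} -> pseries (pseries rat)} :=
      @ps_of_poly _ \o map_poly (@ps_of_poly rat).
    have fC P : f P%:P = ps_const (ps_of_poly P) by rewrite /f /= map_polyC ps_of_polyC.
    have fX : f 'X = ps_X _ by rewrite /f /= map_polyX ps_of_polyX.
    rewrite nested_poly2 -[LHS]/(f WP) /WP rmorphB !(rmorphM f) !fC fX (ev_rmorph f) fX.
    by rewrite /N rmorphM rmorphXn /= !(ev_rmorph (@ps_of_poly rat)) /= ps_of_polyX.
  move=> i j; rewrite big_ord_recl big_ord1 /= !fmul2E nested_fmul2 !nested_fone2 nI ncP nWP.
  by rewrite !mulr1 wI -!psD addNr.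
- by rewrite I0 oner_neq0.
- move=> i j; rewrite fmul2E.
  rewrite (_ : nested _ = Mser M); last by apply: pseriesP => b; apply: pseriesP.
  rewrite (_ : nested _ = I); last by apply: pseriesP => b; apply: pseriesP.
  rewrite /y_dy; have p0 : p%:R != 0 :> rat by rewrite pnatr_eq0 -lt0n.
  apply: (mulfI p0); rewrite mulrA divff // mul1r -psMnat -psMnat mulrA -DI.
  by rewrite -psMnat.
Qed.

Theorem mainTheorem7 (p : nat) (d : fps) (M : nat -> nat -> rat) :
  p \in [:: 2; 3; 5; 7; 13]%N ->
  (* d = d_p : the (p-1)-th root of Delta(q^p)/Delta(q) lying in q + q^2 Q[[q]] *)
  d 0%N = 0 -> d 1%N = 1 ->
  (forall n, fmul (fpow d p.-1) Delta n = Delta_at_pow p n) ->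
  (* U(d^j) = sum_{i>=1} M_ij d^i  (only i <= n contributes to q^n) *)
  (forall j n, (0 < j)%N ->
     U_op p (fpow d j) n = \sum_(1 <= i < n.+1) M i j * fpow d i n) ->
  exists I : fps2,
    algebraic2 I /\ I 0%N 0%N != 0 /\
    (* sum_{i,j>=1} M_ij x^i y^j = (y/p) (d/dy I) / I *)
    forall i j,
      fmul2 (fun a b => if (0 < a)%N && (0 < b)%N then M a b else 0) I i j
      = (p%:R)^-1 * y_dy I i j.
Proof.
rewrite !inE => /or4P[/eqP-> | /eqP-> | /eqP-> | /orP[/eqP->|/eqP->]].
- exact: algebraic_of_level level2 reversal2.
- exact: algebraic_of_level level3 reversal3.
- exact: algebraic_of_level level5 reversal5.
- exact: algebraic_of_level level7 reversal7.
- exact: algebraic_of_level level13 reversal13.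
Qed.
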